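(* Let $0\le k\le n$ and let $r$ be an integer. The pullback map $\Phi^*\colon\Lambda^k(T^n)\to\Lambda^k(S^n)$ induced by $\Phi(u)=(u_1^2,\dotsc,u_{n+1}^2)$ restricts to linear isomorphisms (i.e. it is injective on, and maps onto, the indicated spaces) \begin{align*} \mathcal P_r\Lambda^k(T^n)&\xrightarrow{\ \simeq\ }\mathcal P_{2r+k}\Lambda^k_e(S^n),\\ \mathcal P_r^-\Lambda^k(T^n)&\xrightarrow{\ \simeq\ } *_{S^n}\mathcal P_{2r+k-1}\Lambda^{n-k}_o(S^n),\\ \mathring{\mathcal P}_r\Lambda^k(T^n)&\xrightarrow{\ \simeq\ } u_N\,\mathcal P_{2r+k-n-1}\Lambda^k_o(S^n)\quad\text{if } r\ge1,\\ \mathring{\mathcal P}_r^-\Lambda^k(T^n)&\xrightarrow{\ \simeq\ } u_N\,{*_{S^n}}\mathcal P_{2r+k-n-2}\Lambda^{n-k}_e(S^n). \end{align*}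
   Context: Let $n\ge1$. $T^n=\{x\in\mathbb R^{n+1}: x_i\ge0 \text{ for all } i,\ x_1+\dotsb+x_{n+1}=1\}$ and $S^n=\{u\in\mathbb R^{n+1}: u_1^2+\dotsb+u_{n+1}^2=1\}$. $\Lambda^k(M)$ denotes (smooth) differential $k$-forms on $M$, for $M=T^n$ (smooth up to the boundary), $S^n$, or $\mathbb R^{n+1}$. The restriction of a form on $\mathbb R^{n+1}$ to $T^n$ or $S^n$ is its pullback under inclusion. $\Phi\colon\mathbb R^{n+1}\to\mathbb R^{n+1}$ is $\Phi(u)=(u_1^2,\dotsc,u_{n+1}^2)$; it maps $S^n$ to $T^n$. $\mathcal P_r\Lambda^k(\mathbb R^{n+1})$ is the space of $k$-forms on $\mathbb R^{n+1}$ whose coefficients are polynomials of degree at most $r$ (it is $\{0\}$ if $r<0$). With the radial vector field $X=\sum_{i=1}^{n+1}x_i\frac{\partial}{\partial x_i}$ and interior product $i_X$, $\mathcal P_r^-\Lambda^k(\mathbb R^{n+1}):=i_X\mathcal P_{r-1}\Lambda^{k+1}(\mathbb R^{n+1})$. For $M=T^n$ or $S^n$, $\mathcal P_r\Lambda^k(M)$ and $\mathcal P_r^-\Lambda^k(M)$ are the spaces of restrictions to $M$ of elements of $\mathcal P_r\Lambda^k(\mathbb R^{n+1})$ and $\mathcal P_r^-\Lambda^k(\mathbb R^{n+1})$. $\mathring{\mathcal P}_r\Lambda^k(T^n)$ and $\mathring{\mathcal P}_r^-\Lambda^k(T^n)$ are the subspaces of those forms in $\mathcal P_r\Lambda^k(T^n)$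 and $\mathcal P_r^-\Lambda^k(T^n)$ whose restriction to $\partial T^n$ vanishes, i.e. whose pullback to each facet $\{x\in T^n:x_i=0\}$ is zero. Let $R_i\colon\mathbb R^{n+1}\to\mathbb R^{n+1}$ be the reflection changing the sign of $u_i$. A form $\alpha$ on $S^n$ is even if $R_i^*\alpha=\alpha$ for every $i$, and odd if $R_i^*\alpha=-\alpha$ for every $i$. $\mathcal P_s\Lambda^k_e(S^n)$ and $\mathcal P_s\Lambda^k_o(S^n)$ denote the subspaces of even, respectively odd, forms in $\mathcal P_s\Lambda^k(S^n)$. $*_{S^n}\colon\Lambda^k(S^n)\to\Lambda^{n-k}(S^n)$ is the Hodge star of the standard round metric on $S^n$, oriented by the outward normal (as the boundary of the unit ball). $u_N:=u_1u_2\dotsm u_{n+1}$. For a space $W$ of forms on $S^n$, $*_{S^n}W$ and $u_NW$ denote its images under $*_{S^n}$ and under multiplication by $u_N$. *)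

(* Defs.v *)
From mathcomp Require Import all_boot all_order all_algebra.
From mathcomp Require Import all_classical all_reals all_analysis.
From mathcomp Require mpoly.

Set Implicit Arguments.
Unset Strict Implicit.
Unset Printing Implicit Defensive.
Import Order.TTheory GRing.Theory Num.Theory.
Import numFieldNormedType.Exports.
Local Open Scope classical_set_scope.
Local Open Scope ring_scope.

Section Forms.
Variables (R : realType) (n : nat).
Local Notation V := 'rV[R]_n.+1.

(* A k-form takes a base point and k vectors (the rows of a matrix).  Forms on
   a subset M of R^(n+1) have this same type: they are extended by 0 outside
   the points and tangent vectors of M, so that equality of forms on M is
   Leibniz equality. *)
Definition kform (k : nat) : Type := V -> 'M[R]_(k, n.+1) -> R.

Record domain := Domain { carrier : set V; tangent : V -> set V }.

Definition euclidean : domain := Domain setT (fun _ => setT).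

Definition sphere : domain := Domain
  [set u | \sum_i u 0 i ^+ 2 = 1]
  (fun u => [set v | \sum_i u 0 i * v 0 i = 0]).

(* T^n is a manifold with corners: its tangent space is the same hyperplane at
   every point, including boundary points. *)
Definition simplex : domain := Domain
  [set x | (forall i, 0 <= x 0 i) /\ \sum_i x 0 i = 1]
  (fun _ => [set v | \sum_i v 0 i = 0]).

Definition facet (i : 'I_n.+1) : domain := Domain
  [set x | carrier simplex x /\ x 0 i = 0]
  (fun x => [set v | tangent simplex x v /\ v 0 i = 0]).

Definition tangent_to (M : domain) k (u : V) (v : 'M[R]_(k, n.+1)) : Prop :=
  carrier M u /\ forall j, tangent M u (row j v).

(* Multilinearity and alternation are phrased as in [determinant_multilinear]
   and [determinant_alternate]. *)
Definition is_kform (M : domain) k (w : kform k) : Prop :=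
  [/\ forall u v, ~ tangent_to M u v -> w u v = 0,
      forall u (v v1 v2 : 'M[R]_(k, n.+1)) j a b,
        tangent_to M u v -> tangent_to M u v1 -> tangent_to M u v2 ->
        row j v = a *: row j v1 + b *: row j v2 ->
        row' j v1 = row' j v -> row' j v2 = row' j v ->
        w u v = a * w u v1 + b * w u v2 &
      forall u (v : 'M[R]_(k, n.+1)) j1 j2, tangent_to M u v ->
        j1 != j2 -> row j1 v = row j2 v -> w u v = 0].

Definition restrict_form (M : domain) k (w : kform k) : kform k :=
  fun u v => if `[< tangent_to M u v >] then w u v else 0.

(* Row j of [v *m jacobian f u] is the differential of f at u applied to row j
   of v. *)
Definition pullback (M : domain) (f : V -> V) k (w : kform k) : kform k :=
  restrict_form M (fun u v => w (f u) (v *m jacobian f u)).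

(* The coefficient of dx_i1 /\ ... /\ dx_ik is the value of the form on
   (e_i1, ..., e_ik).  Bounding the degrees of the monomials that occur makes
   0 the only polynomial of degree at most r when r < 0. *)
Definition poly_forms (r : int) k : set (kform k) :=
  [set w | is_kform euclidean w /\
    forall i : 'I_k -> 'I_n.+1, exists p : mpoly.mpoly n.+1 R,
      (forall m, mpoly.mcoeff m p != 0 -> (mpoly.mdeg m)%:Z <= r) /\
      forall x, w x (\matrix_(j < k) delta_mx 0 (i j))
                = mpoly.meval (fun l => x 0 l) p].

Definition interior_radial k (w : kform k.+1) : kform k :=
  fun x v => w x (col_mx x v).

Definition poly_minus_forms (r : int) k : set (kform k) :=
  [set interior_radial w | w in @poly_forms (r - 1) k.+1].

Definition poly_forms_on (M : domain) (r : int) k : set (kform k) :=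
  [set restrict_form M w | w in @poly_forms r k].

Definition poly_minus_forms_on (M : domain) (r : int) k : set (kform k) :=
  [set restrict_form M w | w in @poly_minus_forms r k].

Definition vanishing_on_boundary k : set (kform k) :=
  [set w | forall i, restrict_form (facet i) w = 0].

Definition reflection (i : 'I_n.+1) (u : V) : V :=
  \row_j (if j == i then - u 0 j else u 0 j).

Definition even_forms k : set (kform k) :=
  [set w | forall i, pullback sphere (reflection i) w = w].

Definition odd_forms k : set (kform k) :=
  [set w | forall i, pullback sphere (reflection i) w = - w].

(* The rows of e form an orthonormal basis of the tangent space of S^n at u
   which is positively oriented, the outward normal u being put first. *)
Definition oriented_frame (u : V) (e : 'M[R]_(n, n.+1)) : Prop :=
  [/\ forall j, tangent sphere u (row j e),
      e *m e^T = 1%:M &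
      0 < \det (col_mx u e : 'M[R]_n.+1)].

Definition hodge_dual k l (hkl : (k + l)%N = n) (w : kform k) (w' : kform l)
    : Prop :=
  forall u (e : 'M[R]_(n, n.+1)), carrier sphere u -> oriented_frame u e ->
    w' u (rowsub (fun j => cast_ord hkl (rshift k j)) e)
    = w u (rowsub (fun j => cast_ord hkl (lshift l j)) e).

(* The Hodge star of w is the unique form w' on S^n with
   w'(e_(k+1), ..., e_n) = w(e_1, ..., e_k)
   for every oriented orthonormal frame (e_1, ..., e_n) of S^n. *)
Definition hodge_star k l (hkl : (k + l)%N = n) (w : kform k) : kform l :=
  xget 0 [set w' | is_kform sphere w' /\ hodge_dual hkl w w'].

Definition mul_uN k (w : kform k) : kform k :=
  fun u v => (\prod_i u 0 i) * w u v.

Definition Phi (u : V) : V := \row_i (u 0 i ^+ 2).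

Definition linear_iso k l (A : set (kform k)) (B : set (kform l))
    (f : kform k -> kform l) : Prop :=
  (forall a w1 w2, A w1 -> A w2 -> f (a *: w1 + w2) = a *: f w1 + f w2) /\
  set_bij A B f.

End Forms.

Arguments poly_forms_on {R n} M r k.
Arguments poly_minus_forms_on {R n} M r k.
Arguments sphere {R n}.
Arguments simplex {R n}.
Arguments vanishing_on_boundary {R n k}.
Arguments even_forms {R n k}.
Arguments odd_forms {R n k}.
Arguments Phi {R n}.

(* Main.v *)
(** An even polynomial form w on R^(n+1) is a pullback: its coefficient on
    dx_I is odd in u_i exactly for i in I, hence equals (prod_(i in I) u_i) times
    a polynomial in the squares.  Averaging over reflections extends every even
    or odd form on the sphere to an even or odd form on R^(n+1), which gives the
    first isomorphism.  Since Phi^* i_X = (1/2) i_U Phi^* (U the radial field in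
    the u variables), and the dual on the sphere of a restricted form beta is the
    restriction of i_U (star beta) for the Euclidean star, which exchanges
    parities, the second one follows.  For the forms vanishing on the boundary,
    homogenize with x_1 + ... + x_(n+1) = 1: vanishing on the boundary makes a
    homogeneous form in the image of i_U divisible by u_N, and the quotient is
    again in the image of i_U, because it is killed by i_U and the Koszul complex
    is exact. *)
Require Import Defs.
From mathcomp Require Import all_boot all_order all_fingroup all_algebra.
From mathcomp Require Import all_classical all_reals all_analysis.
From mathcomp Require mpoly.
Import -(notations) mpoly.
From mathcomp Require Import ring lra zify.

Set Implicit Arguments.
Unset Strict Implicit.
Unset Printing Implicit Defensive.
Import Order.TTheory GRing.Theory Num.Theory.
Local Open Scope ring_scope.

(** The third map meets an obstacle: if $\eta$ vanishes on the boundary, $w=\Phi^*\eta$ vanishes at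
    $u_i=0$ only on vectors tangent to the sphere, so its coefficients need not be divisible by
    $u_N$. The dual $i_U\zeta$ ignores radial components: vanishing on tangent vectors at sphere
    points with $u_i=0$ makes it vanish on all vectors there, and homogeneity carries this to the
    whole hyperplane. So the dual of $w$ is divided, and the duality is then undone. Koszul
    exactness fails only for constants in form degree 0, that is when $i_U\zeta$ is a constant
    multiple of $u_N$. For the fourth map parity excludes this. For the third it would mean $k=n$
    and $r=0$, whence the hypothesis $r\ge1$: a constant volume form on $T^n$ vanishes on the
    boundary, while the target, of degree $-1$, is zero. Alternation, parity and divisibility are
    handled as polynomial identities on $\mathbb R^{n+1}$, provable on a dense set; restriction to
    the sphere or the simplex comes last. *)

Section PolynomialFunctions.
Variables (R : realType) (N : nat).
Implicit Types (m : multinom N) (p q : mpoly N R) (f g : 'rV[R]_N -> R).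

(** * Polynomial functions and independence of monomials *)

Definition ev p (x : 'rV[R]_N) : R := meval (fun l => x 0 l) p.

Definition monom m (x : 'rV[R]_N) : R := \prod_i x 0 i ^+ m i.

Lemma evE p x : ev p x = \sum_(m <- msupp p) mcoeff m p * monom m x.
Proof. by []. Qed.

Lemma ev_lin a b p q x : ev (a *: p + b *: q) x = a * ev p x + b * ev q x.
Proof. by rewrite /ev mevalD !mevalZ. Qed.

Lemma evM p q x : ev (p * q) x = ev p x * ev q x.
Proof. by rewrite /ev mevalM. Qed.

Lemma evX m x : ev (mpolyX R m) x = monom m x.
Proof. by rewrite /ev mevalX. Qed.

Lemma ev_sum (I : Type) (s : seq I) (P : pred I) (F : I -> mpoly N R) x :
  ev (\sum_(i <- s | P i) F i) x = \sum_(i <- s | P i) ev (F i) x.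
Proof. by rewrite /ev raddf_sum. Qed.

Lemma monom1 (i : 'I_N) x : monom (mnm1 i) x = x 0 i.
Proof.
rewrite /monom (bigD1 i)//= mnmE eqxx expr1 big1 ?mulr1// => j ji.
by rewrite mnmE eq_sym (negPf ji) expr0.
Qed.

Lemma monomD m m' x : monom (mnm_add m m') x = monom m x * monom m' x.
Proof.
by rewrite /monom -big_split; apply: eq_bigr => i _; rewrite mnmE exprD.
Qed.

(* Independence of characters: scaling one coordinate by 2 separates two
   distinct monomials. *)
Lemma monom_free (s : seq (multinom N)) (c : multinom N -> R) :
  uniq s -> (forall x, \sum_(m <- s) c m * monom m x = 0) ->
  forall m, m \in s -> c m = 0.
Proof.
elim: s c => [//|m0 s IHs] c /= /andP[m0s us] c0.
have cs m : m \in s -> c m = 0.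
  move=> ms.
  have [i mi] : exists i, m i != m0 i.
    apply/existsP; rewrite -[X in is_true X]negbK negb_exists.
    apply/negP => /forallP h; move: m0s; suff <- : m = m0 by rewrite ms.
    by apply/mnmP => i; apply/eqP; rewrite -[X in is_true X]negbK h.
  have : c m * (2 ^+ m i - 2 ^+ m0 i) = 0.
    apply: (IHs (fun m => c m * (2 ^+ m i - 2 ^+ m0 i))) => // x.
    pose y : 'rV[R]_N := \row_j (x 0 j *+ (j == i).+1).
    have my m' : monom m' y = 2 ^+ m' i * monom m' x.
      rewrite /monom (bigD1 i)//= [in RHS](bigD1 i)//= mxE eqxx.
      rewrite -[x 0 i *+ _]mulr_natl exprMn -mulrA; congr (_ * (_ * _)).
      by apply: eq_bigr => j ji; rewrite mxE (negPf ji).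
    transitivity (\sum_(m <- m0 :: s) c m * monom m y
                  - 2 ^+ m0 i * \sum_(m <- m0 :: s) c m * monom m x).
      rewrite mulr_sumr -sumrB big_cons my mulrCA subrr add0r.
      by apply: eq_bigr => m' _; rewrite my; ring.
    by rewrite !c0 mulr0 subrr.
  move/eqP; rewrite mulf_eq0 => /orP[/eqP//|].
  rewrite subr_eq0 => /eqP /ieexprIn mm.
  by rewrite mm ?eqxx// ?pnatr_eq1// in mi.
move=> m; rewrite inE => /orP[/eqP->|/cs//].
have := c0 (const_mx 1); rewrite big_cons big_seq big1 => [|m' /cs ->]; last first.
  by rewrite mul0r.
rewrite addr0 /monom big1 ?mulr1// => i _; by rewrite mxE expr1n.
Qed.

Lemma ev_inj p q : (forall x, ev p x = ev q x) -> p = q.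
Proof.
move=> pq; apply/eqP; rewrite -subr_eq0; apply/eqP/msuppnil0.
set d := p - q.
have d0 m : m \in msupp d -> mcoeff m d = 0.
  apply: (@monom_free (msupp d) (fun m => mcoeff m d)) => [|x]; first exact: msupp_uniq.
  by rewrite -evE /d /ev mevalB -/(ev p x) -/(ev q x) pq subrr.
case sd: (msupp d) => [//|m s].
have ms : m \in msupp d by rewrite sd mem_head.
by move: (ms); rewrite mcoeff_msupp d0// eqxx.
Qed.

(** The predicate [D] on exponents covers degree bounds, homogeneity and no condition at all; an
    empty [D], as for a negative degree, leaves only the zero function. *)
Definition polyfun (D : multinom N -> Prop) f : Prop :=
  exists p, (forall m, mcoeff m p != 0 -> D m) /\ forall x, f x = ev p x.

Lemma polyfun_ev (D : multinom N -> Prop) p :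
  (forall m, mcoeff m p != 0 -> D m) -> polyfun D (ev p).
Proof. by move=> Dp; exists p. Qed.

Lemma eq_polyfun (D D' : multinom N -> Prop) f g :
  f =1 g -> (forall m, D m -> D' m) -> polyfun D f -> polyfun D' g.
Proof.
by move=> fg DD' [p [Dp fp]]; exists p; split=> [m /Dp /DD'//|x]; rewrite -fg.
Qed.

Lemma polyfun0 D : polyfun D (fun=> 0).
Proof.
by exists 0; split=> [m|x]; rewrite ?mcoeff0 ?eqxx// /ev meval0.
Qed.

Lemma polyfunDZ D a b f g :
  polyfun D f -> polyfun D g -> polyfun D (fun x => a * f x + b * g x).
Proof.
move=> [p [Dp fp]] [q [Dq gq]]; exists (a *: p + b *: q); split=> [m|x].
  rewrite mcoeffD !mcoeffZ.
  have [->|/Dp//] := eqVneq (mcoeff m p) 0.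
  have [->|/Dq//] := eqVneq (mcoeff m q) 0.
  by rewrite !mulr0 addr0 eqxx.
by rewrite ev_lin fp gq.
Qed.

Lemma polyfunZ D a f : polyfun D f -> polyfun D (fun x => a * f x).
Proof.
move=> Df; apply: eq_polyfun (polyfunDZ a 0 Df Df) => // x.
by rewrite mul0r addr0.
Qed.

Lemma polyfunD D f g : polyfun D f -> polyfun D g -> polyfun D (fun x => f x + g x).
Proof.
move=> Df Dg; apply: eq_polyfun (polyfunDZ 1 1 Df Dg) => // x.
by rewrite !mul1r.
Qed.

Lemma polyfun_sum D (I : Type) (s : seq I) (P : pred I) (F : I -> 'rV_N -> R) :
  (forall i, P i -> polyfun D (F i)) -> polyfun D (fun x => \sum_(i <- s | P i) F i x).
Proof.
move=> DF; elim: s => [|i s IHs].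
  by apply: eq_polyfun (polyfun0 D) => // x; rewrite big_nil.
case Pi: (P i).
  by apply: eq_polyfun (polyfunD (DF i Pi) IHs) => // x; rewrite big_cons Pi.
by apply: eq_polyfun IHs => // x; rewrite big_cons Pi.
Qed.

Lemma polyfun_monom (D : multinom N -> Prop) m : D m -> polyfun D (monom m).
Proof.
move=> Dm; exists (mpolyX R m); split=> [m'|x]; last by rewrite evX.
by rewrite mcoeffX; have [<-|] := eqVneq m m'; rewrite ?eqxx.
Qed.

Lemma polyfunM_monom (D D' : multinom N -> Prop) m0 f :
  (forall m, D m -> D' (mnm_add m0 m)) -> polyfun D f ->
  polyfun D' (fun x => monom m0 x * f x).
Proof.
move=> DD' [p [Dp fp]].
apply: (@eq_polyfun D' _ (fun x => \sum_(m <- msupp p)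
     mcoeff m p * (monom m0 x * monom m x))) => // [x|].
  by rewrite fp evE mulr_sumr; apply: eq_bigr => m _; rewrite mulrCA.
rewrite (_ : (fun _ => _) = (fun x => \sum_(m <- msupp p)
     if mcoeff m p != 0 then mcoeff m p * (monom (mnm_add m0 m) x) else 0)).
  apply: polyfun_sum => m _ /=.
  have [_|/Dp /DD' Dm] := eqVneq (mcoeff m p) 0 => /=; first exact: polyfun0.
  by apply: polyfunZ; apply: polyfun_monom.
apply/funext => x; apply: eq_bigr => m _; case: eqVneq => [->|_] /=.
  by rewrite mul0r.
by rewrite monomD.
Qed.

(** Serves the two substitutions that occur: reflections, where [c m] is a sign, and [Phi], where
    [e] doubles exponents. *)
Lemma polyfun_comp (D D' : multinom N -> Prop) (h : 'rV[R]_N -> 'rV[R]_N)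
    (c : multinom N -> R) (e : multinom N -> multinom N) f :
  (forall m x, monom m (h x) = c m * monom (e m) x) ->
  (forall m, D m -> D' (e m)) ->
  polyfun D f -> polyfun D' (fun x => f (h x)).
Proof.
move=> he DD' [p [Dp fp]].
apply: (@eq_polyfun D' _ (fun x => \sum_(m <- msupp p)
     if mcoeff m p != 0 then mcoeff m p * c m * monom (e m) x else 0)) => // [x|].
  rewrite fp evE; apply: eq_bigr => m _; rewrite he; case: eqVneq => [->|_] /=.
    by rewrite mul0r.
  by rewrite mulrA.
apply: polyfun_sum => m _ /=.
  have [_|/Dp /DD' Dm] := eqVneq (mcoeff m p) 0 => /=; first exact: polyfun0.
by apply: polyfunZ; apply: polyfun_monom.
Qed.

(** Zariski density, from the absence of zero divisors: an identity checked off the zero set of [g]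
    holds everywhere. *)
Lemma polyfun_mul_eq0 D D' f g :
  polyfun D f -> polyfun D' g -> (forall x, f x * g x = 0) ->
  (exists x, g x != 0) -> forall x, f x = 0.
Proof.
move=> [p [_ fp]] [q [_ gq]] fg0 [y gy] x.
have : p * q = 0.
  by apply: ev_inj => z; rewrite evM -fp -gq fg0 /ev meval0.
move/eqP; rewrite mulf_eq0 => /orP[/eqP p0|/eqP q0].
  by rewrite fp p0 /ev meval0.
by move: gy; rewrite gq q0 /ev meval0 eqxx.
Qed.

Lemma polyfun_line D f (x y : 'rV[R]_N) : polyfun D f ->
  exists q : {poly R}, forall t, f (x + t *: y) = q.[t].
Proof.
move=> [p [_ fp]].
exists (\sum_(m <- msupp p) (mcoeff m p)%:P *
   \prod_i ((x 0 i)%:P + 'X * (y 0 i)%:P) ^+ m i) => t.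
rewrite fp evE horner_sum; apply: eq_bigr => m _.
rewrite hornerM hornerC horner_prod; congr (_ * _); apply: eq_bigr => i _.
by rewrite horner_exp !hornerE !mxE.
Qed.

End PolynomialFunctions.

(** * Parity, divisibility by $u_N$, homogenization and Euler's identity *)

Section ParityAndDegree.
Variables (R : realType) (n : nat).
Local Notation N := n.+1.
Local Notation V := 'rV[R]_N.
Implicit Types (m : multinom N) (p q : mpoly N R) (f g : V -> R).

Definition deg_le (r : int) (m : multinom N) : Prop := (mdeg m)%:Z <= r.
Definition deg_eq (r : int) (m : multinom N) : Prop := (mdeg m)%:Z = r.

Lemma monom_reflection m i (x : V) :
  monom m (reflection i x) = (-1) ^+ m i * monom m x.
Proof.
rewrite /monom (bigD1 i)//= [in RHS](bigD1 i)//= mxE eqxx [in LHS]exprNn -mulrA.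
by congr (_ * (_ * _)); apply: eq_bigr => j ji; rewrite mxE (negPf ji).
Qed.

Lemma polyfun_reflection D f i : polyfun D f -> polyfun D (fun x => f (reflection i x)).
Proof.
apply: (@polyfun_comp _ _ D D (reflection i) (fun m => (-1) ^+ m i) id) => // m x.
exact: monom_reflection.
Qed.

Definition mdouble m : multinom N := mnm_add m m.

Lemma monom_Phi m (x : V) : monom m (Phi x) = monom (mdouble m) x.
Proof.
rewrite monomD /monom -big_split; apply: eq_bigr => i _.
by rewrite mxE -exprM mul2n -addnn exprD.
Qed.

Lemma polyfun_Phi D D' f : (forall m, D m -> D' (mdouble m)) -> polyfun D f ->
  polyfun D' (fun x => f (Phi x)).
Proof.
move=> DD'; apply: (@polyfun_comp _ _ D D' Phi (fun=> 1) mdouble) => // m x.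
by rewrite mul1r monom_Phi.
Qed.


Definition mnm (E : 'I_N -> nat) : multinom N := Multinom [tuple E i | i < N].

Definition mhalf m := mnm (fun i => (m i)./2).
Definition mpred m := mnm (fun i => (m i).-1).
Definition mindic (S : {set 'I_N}) := mnm (fun i => (i \in S) : nat).

Lemma monom_mindic S (x : V) : monom (mindic S) x = \prod_(i in S) x 0 i.
Proof.
rewrite /monom [in RHS]big_mkcond; apply: eq_bigr => i _.
by rewrite mnmE; case: (i \in S).
Qed.

Lemma mdeg_mindic S : mdeg (mindic S) = #|S|.
Proof.
rewrite mdegE -sum1_card [in RHS]big_mkcond; apply: eq_bigr => i _.
by rewrite mnmE; case: (i \in S).
Qed.

(** Reflection multiplies the coefficient of [m] by [(-1) ^+ m i]; independence of monomials lets
    coefficients be compared one by one. *)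
Lemma parity_support p (S : {set 'I_N}) :
  (forall i x, ev p (reflection i x) = (-1) ^+ (i \in S) * ev p x) ->
  forall m i, mcoeff m p != 0 -> odd (m i) = (i \in S).
Proof.
move=> pS m i pm; apply/eqP.
have : mcoeff m p * ((-1) ^+ m i - (-1) ^+ (i \in S)) = 0.
  apply: (@monom_free _ _ (msupp p)
     (fun m => mcoeff m p * ((-1) ^+ m i - (-1) ^+ (i \in S)))) => [|x|].
  - exact: msupp_uniq.
  - transitivity (ev p (reflection i x) - (-1) ^+ (i \in S) * ev p x).
      rewrite !evE mulr_sumr -sumrB; apply: eq_bigr => m' _.
      by rewrite monom_reflection; ring.
    by rewrite pS subrr.
  - by rewrite mcoeff_msupp.
move/eqP; rewrite mulf_eq0 (negPf pm) /= -signr_odd.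
by case: (odd _); case: (_ \in _); rewrite // ?expr0 ?expr1 => /eqP h; lra.
Qed.

(** Every occurring exponent has its odd entries exactly at [S], so it splits as [mindic S] plus the
    double of [mhalf m]. *)
Lemma parity_factor (D D' : multinom N -> Prop) f (S : {set 'I_N}) :
  polyfun D f ->
  (forall i x, f (reflection i x) = (-1) ^+ (i \in S) * f x) ->
  (forall m, D m -> (forall i, odd (m i) = (i \in S)) -> D' (mhalf m)) ->
  exists2 g, polyfun D' g & forall x, f x = (\prod_(i in S) x 0 i) * g (Phi x).
Proof.
move=> [p [Dp fp]] fS DD'.
have pS m i : mcoeff m p != 0 -> odd (m i) = (i \in S).
  by apply: parity_support => j x; rewrite -!fp fS.
exists (fun x => \sum_(m <- msupp p)
    if mcoeff m p != 0 then mcoeff m p * monom (mhalf m) x else 0).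
  apply: polyfun_sum => m _ /=.
  have [_|pm] := eqVneq (mcoeff m p) 0; first exact: polyfun0.
  by apply: polyfunZ; apply: polyfun_monom; apply: DD' => [|i]; [exact: Dp|exact: pS].
move=> x; rewrite fp evE mulr_sumr; apply: eq_bigr => m _.
have [->|pm] := eqVneq (mcoeff m p) 0; first by rewrite !mul0r mulr0.
rewrite mulrCA; congr (_ * _); rewrite -monom_mindic monom_Phi -monomD.
congr (monom _ x); apply/mnmP => i; rewrite !mnmE -(pS m i pm) addnn.
by rewrite odd_double_half.
Qed.

Definition uN (x : V) : R := \prod_i x 0 i.

Lemma polyfunM_uN (D D' : multinom N -> Prop) f :
  (forall m, D m -> D' (mnm_add (mindic finset.setT) m)) ->
  polyfun D f -> polyfun D' (fun x => uN x * f x).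
Proof.
move=> DD' Df; apply: (eq_polyfun _ _ (polyfunM_monom DD' Df)) => // x.
by rewrite monom_mindic; congr (_ * _); apply: eq_bigl => i; rewrite inE.
Qed.

(** Setting $x_i=0$ kills exactly the monomials that contain $x_i$; by independence no other
    monomial can occur. *)
Lemma divide_uN (D D' : multinom N -> Prop) f :
  polyfun D f -> (forall i (x : V), x 0 i = 0 -> f x = 0) ->
  (forall m, D m -> (forall i, (0 < m i)%N) -> D' (mpred m)) ->
  exists2 g, polyfun D' g & forall x, f x = uN x * g x.
Proof.
move=> [p [Dp fp]] f0 DD'.
have p0 m i : mcoeff m p != 0 -> (0 < m i)%N.
  move=> pm; rewrite lt0n; apply: contra pm => mi0; apply/eqP.
  transitivity (mcoeff m p * (m i == 0)%:R); first by rewrite mi0 mulr1.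
  have [/memN_msupp_eq0-> |pm] := boolP (m \notin msupp p).
    by rewrite mul0r.
  apply: (@monom_free _ _ (msupp p) (fun m => mcoeff m p * (m i == 0)%:R)) => [|x|].
  - exact: msupp_uniq.
  - pose y : V := \row_j (if j == i then 0 else x 0 j).
    have := f0 i y; rewrite mxE eqxx => /(_ erefl).
    rewrite fp evE => h; rewrite -[RHS]h; apply: eq_bigr => m' _.
    rewrite -mulrA; congr (_ * _); rewrite /monom (bigD1 i)//= [in RHS](bigD1 i)//=.
    rewrite mxE eqxx expr0n; case: eqVneq => [->|_] /=; last by rewrite !mul0r.
    rewrite expr0 !mul1r; apply: eq_bigr => j ji.
    by rewrite mxE (negPf ji).
  - by rewrite -[_ \in _]negbK.
exists (fun x => \sum_(m <- msupp p)
    if mcoeff m p != 0 then mcoeff m p * monom (mpred m) x else 0).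
  apply: polyfun_sum => m _ /=.
  have [_|pm] := eqVneq (mcoeff m p) 0; first exact: polyfun0.
  by apply: polyfunZ; apply: polyfun_monom; apply: DD' => [|i]; [exact: Dp|exact: p0].
move=> x; rewrite fp evE mulr_sumr; apply: eq_bigr => m _.
have [->|pm] := eqVneq (mcoeff m p) 0; first by rewrite !mul0r mulr0.
rewrite mulrCA; congr (_ * _).
rewrite (_ : uN x = monom (mindic finset.setT) x); last first.
  by rewrite monom_mindic; apply: eq_bigl => i; rewrite inE.
rewrite -monomD; congr (monom _ x); apply/mnmP => i; rewrite !mnmE inE.
by rewrite add1n prednK// p0.
Qed.

Lemma polyfunM_coord r (i : 'I_N) f : polyfun (deg_eq r) f ->
  polyfun (deg_eq (r + 1)) (fun x => x 0 i * f x).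
Proof.
move=> rf; apply: (eq_polyfun _ _ (@polyfunM_monom _ _ _ (deg_eq (r + 1)) (mnm1 i) f _ rf)) => //.
  by move=> x; rewrite monom1.
by move=> m; rewrite /deg_eq mdegD mdeg1 => <-; lia.
Qed.

(** Each monomial is padded with the power of $\sum_i x_i$ that brings it to degree [d]; on the
    hyperplane of the simplex this factor is 1. *)
Lemma homogenize (d : nat) f : polyfun (deg_le d%:Z) f ->
  exists2 g, polyfun (deg_eq d%:Z) g &
    forall x : V, \sum_i x 0 i != 0 ->
      g x = (\sum_i x 0 i) ^+ d * f ((\sum_i x 0 i)^-1 *: x).
Proof.
move=> [p [Dp fp]].
have hom m k : polyfun (deg_eq (mdeg m + k)%N%:Z)
    (fun x : V => (\sum_i x 0 i) ^+ k * monom m x).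
  elim: k => [|k IHk].
    apply: eq_polyfun (@polyfun_monom R _ (deg_eq (mdeg m)%:Z) m erefl) => //.
      by move=> x; rewrite mul1r.
    by move=> m'; rewrite addn0.
  apply: (@eq_polyfun _ _ (deg_eq ((mdeg m + k)%N%:Z + 1)) _ (fun x : V =>
     \sum_i x 0 i * ((\sum_i x 0 i) ^+ k * monom m x))) => [x|m'|].
  - by rewrite -mulr_suml exprS mulrA.
  - by rewrite /deg_eq => ->; lia.
  - by apply: polyfun_sum => i _; apply: polyfunM_coord.
exists (fun x : V => \sum_(m <- msupp p)
    if mcoeff m p != 0
    then mcoeff m p * ((\sum_i x 0 i) ^+ (d - mdeg m) * monom m x) else 0).
  apply: polyfun_sum => m _ /=.
  have [_|pm] := eqVneq (mcoeff m p) 0; first exact: polyfun0.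
  by apply: polyfunZ; have := hom m (d - mdeg m)%N; rewrite subnKC//; apply: Dp.
move=> x x0; rewrite fp evE mulr_sumr; apply: eq_bigr => m _.
have [->|pm] := eqVneq (mcoeff m p) 0; first by rewrite !mul0r mulr0.
rewrite [RHS]mulrCA; congr (_ * _).
have -> : monom m ((\sum_i x 0 i)^-1 *: x)
    = (\sum_i x 0 i)^-1 ^+ mdeg m * monom m x.
  rewrite mdegE -prodrXr /monom -big_split; apply: eq_bigr => i _ /=.
  by rewrite mxE exprMn.
rewrite mulrA; congr (_ * _); rewrite exprVn -[in RHS](subnK (Dp m pm : (mdeg m <= d)%N)) exprD.
by rewrite mulfK ?expf_neq0.
Qed.

Lemma euler p (d : int) : (forall m, mcoeff m p != 0 -> deg_eq d m) ->
  \sum_i mpolyX R (mnm1 i) * mderiv i p = d%:~R *: p.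
Proof.
move=> pd; rewrite [in RHS](mpolyE p) scaler_sumr.
transitivity (\sum_i \sum_(m <- msupp p)
    mpolyX R (mnm1 i) * mderiv i (mcoeff m p *: mpolyX R m)).
  by apply: eq_bigr => i _; rewrite {1}(mpolyE p) raddf_sum mulr_sumr.
rewrite exchange_big /=; apply: eq_big_seq => m.
rewrite mcoeff_msupp => /pd md.
transitivity (\sum_i ((m i)%:R * mcoeff m p) *: mpolyX R m).
  apply: eq_bigr => i _; rewrite mderivZ mderivX -!scalerAr scalerA mulrC.
  (* Truncated subtraction gives a wrong exponent when [m i = 0], but then the coefficient is 0. *)
  have [->|mi] := eqVneq (m i) 0%N; first by rewrite !mul0r !scale0r.
  congr (_ *: _); rewrite -mpolyXD; congr (mpolyX R _).
  by rewrite addmC submK// lep1mP.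
rewrite -scaler_suml -mulr_suml -natr_sum -mdegE -scalerA.
by rewrite -md.
Qed.

Lemma mderiv_deg_eq i p (d : int) : (forall m, mcoeff m p != 0 -> deg_eq d m) ->
  forall m, mcoeff m (mderiv i p) != 0 -> deg_eq (d - 1) m.
Proof.
move=> pd m; rewrite mcoeff_deriv => h.
have /pd : mcoeff (mnm_add m (mnm1 i)) p != 0.
  by apply: contraNneq h => ->; rewrite mul0rn.
by rewrite /deg_eq mdegD mdeg1 => <-; lia.
Qed.

End ParityAndDegree.

(** * Linear algebra of multilinear and alternating functions of the rows *)

Section Alternating.
Variables (R : numFieldType).

Definition multilinear k N (w : 'M[R]_(k, N) -> R) : Prop :=
  forall (v v1 v2 : 'M[R]_(k, N)) j a b,
    row j v = a *: row j v1 + b *: row j v2 ->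
    row' j v1 = row' j v -> row' j v2 = row' j v ->
    w v = a * w v1 + b * w v2.

Definition alternate k N (w : 'M[R]_(k, N) -> R) : Prop :=
  multilinear w /\
  forall (v : 'M[R]_(k, N)) j1 j2, j1 != j2 -> row j1 v = row j2 v -> w v = 0.

Lemma row_row'P k N (j : 'I_k) (v v1 : 'M[R]_(k, N)) : row' j v1 = row' j v ->
  forall i, i != j -> forall l, v1 i l = v i l.
Proof.
move=> /matrixP h i ij l; case: (unliftP j i) ij => [i' ->|->]; last by rewrite eqxx.
by move=> _; have := h i' l; rewrite !mxE.
Qed.

Lemma row_eqP k N k' (i : 'I_k) (j : 'I_k') (v : 'M[R]_(k, N)) (v' : 'M[R]_(k', N)) :
  row i v = row j v' <-> forall l, v i l = v' j l.
Proof.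
split=> [/rowP h l|h]; first by have := h l; rewrite !mxE.
by apply/rowP => l; rewrite !mxE.
Qed.

Definition setrow k N (j : 'I_k) (r : 'rV[R]_N) (v : 'M[R]_(k, N)) :=
  \matrix_(i, l) (if i == j then r 0 l else v i l).

Lemma row_setrow k N (j : 'I_k) (r : 'rV[R]_N) v : row j (setrow j r v) = r.
Proof. by apply/rowP => l; rewrite !mxE eqxx. Qed.

Lemma row'_setrow k N (j : 'I_k) (r : 'rV[R]_N) v : row' j (setrow j r v) = row' j v.
Proof.
by apply/matrixP => i l; rewrite !mxE eq_sym (negPf (neq_lift j i)).
Qed.

Lemma setrow_id k N (j : 'I_k) (v : 'M[R]_(k, N)) : setrow j (row j v) v = v.
Proof. by apply/matrixP => i l; rewrite !mxE; case: eqP => [->|]. Qed.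

Lemma multilinear_setrow k N (w : 'M[R]_(k, N) -> R) j v a b r1 r2 :
  multilinear w ->
  w (setrow j (a *: r1 + b *: r2) v) =
  a * w (setrow j r1 v) + b * w (setrow j r2 v).
Proof. by move=> mw; apply: (mw _ _ _ j); rewrite ?row_setrow ?row'_setrow. Qed.

Lemma multilinear_sum k N (w : 'M[R]_(k, N) -> R) j v (I : Type) (s : seq I)
    (c : I -> R) (r : I -> 'rV[R]_N) :
  multilinear w ->
  w (setrow j (\sum_(i <- s) c i *: r i) v) = \sum_(i <- s) c i * w (setrow j (r i) v).
Proof.
move=> mw; elim: s => [|i s IHs].
  have := multilinear_setrow j v 0 0 0 0 mw.
  by rewrite !big_nil !scale0r addr0 !mul0r addr0.
rewrite !big_cons -IHs -[X in _ *: _ + X]scale1r.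
by rewrite multilinear_setrow// mul1r.
Qed.

Definition basis_rows k N (f : 'I_k -> 'I_N) : 'M[R]_(k, N) := rowsub f 1%:M.

Lemma basis_rowsE k N (f : 'I_k -> 'I_N) i l : basis_rows f i l = (f i == l)%:R.
Proof. by rewrite !mxE. Qed.

Lemma multilinear_eq k N (w w' : 'M[R]_(k, N) -> R) :
  multilinear w -> multilinear w' ->
  (forall f, w (basis_rows f) = w' (basis_rows f)) -> w =1 w'.
Proof.
move=> mw mw' ww' v.
(* [s] lists the rows that may not be basis vectors yet; each induction step expands one of them. *)
suff H (s : seq 'I_k) u : (forall j, j \notin s -> exists i, row j u = delta_mx 0 i) ->
    w u = w' u.
  by apply: (H (enum 'I_k)) => j; rewrite mem_enum.
elim: s u => [|j s IHs] u hu.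
  have /fin_all_exists [f hf] : forall j, exists i, row j u = delta_mx 0 i.
    by move=> j; apply: hu.
  suff -> : u = basis_rows f by apply: ww'.
  apply/matrixP => i l; rewrite basis_rowsE.
  by have /rowP/(_ l) := hf i; rewrite !mxE eqxx eq_sym.
rewrite -(setrow_id j u) (row_sum_delta (row j u)) !multilinear_sum//.
apply: eq_bigr => i _; congr (_ * _); apply: IHs => j' j's.
have [->|jj'] := eqVneq j' j; first by exists i; rewrite row_setrow.
have [|i' hi'] := hu j'; first by rewrite inE negb_or jj'.
exists i'; rewrite -hi'; apply/rowP => l.
by rewrite !mxE (negPf jj').
Qed.

Lemma multilinear_prod k N (f : 'I_k -> 'I_N) :
  multilinear (fun v : 'M[R]_(k, N) => \prod_j v j (f j)).
Proof.
move=> v v1 v2 j a b /rowP hj h1 h2.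
rewrite (bigD1 j)//= [X in _ = a * X + _](bigD1 j)//= [X in _ = _ + b * X](bigD1 j)//= !mulrA.
have -> : v j (f j) = a * v1 j (f j) + b * v2 j (f j).
  by have := hj (f j); rewrite !mxE.
rewrite mulrDl; congr (_ * _ + _ * _); apply: eq_bigr => i ij; apply/esym.
- exact: (row_row'P h1).
- exact: (row_row'P h2).
Qed.

Lemma multilinear_lin k N (I : Type) (s : seq I) (P : pred I) (c : I -> R)
    (w : I -> 'M[R]_(k, N) -> R) :
  (forall i, P i -> multilinear (w i)) ->
  multilinear (fun v => \sum_(i <- s | P i) w i v * c i).
Proof.
move=> mw v v1 v2 j a b hj h1 h2; rewrite !mulr_sumr -big_split /=.
apply: eq_bigr => i Pi.
by rewrite (mw i Pi v v1 v2 j a b)// mulrDl !mulrA.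
Qed.

Lemma alternate_lin k N (I : Type) (s : seq I) (P : pred I) (c : I -> R)
    (w : I -> 'M[R]_(k, N) -> R) :
  (forall i, P i -> alternate (w i)) ->
  alternate (fun v => \sum_(i <- s | P i) w i v * c i).
Proof.
move=> aw; split; first by apply: multilinear_lin => i /aw[].
move=> v j1 j2 j12 hj; apply: big1 => i /aw[_ wi].
by rewrite (wi v j1 j2)// mul0r.
Qed.

Lemma multilinear_mulmxr k m N (w : 'M[R]_(k, N) -> R) (A : 'M[R]_(m, N)) :
  multilinear w -> multilinear (fun v => w (v *m A)).
Proof.
move=> mw v v1 v2 j a b hj h1 h2; apply: (mw _ _ _ j).
- by rewrite !row_mul hj mulmxDl !scalemxAl.
- have row'M (B : 'M[R]_(k, m)) : row' j (B *m A) = row' j B *m A.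
    by apply/matrixP => x y; rewrite !mxE; apply: eq_bigr => z _; rewrite !mxE.
  by rewrite !row'M h1.
- have row'M (B : 'M[R]_(k, m)) : row' j (B *m A) = row' j B *m A.
    by apply/matrixP => x y; rewrite !mxE; apply: eq_bigr => z _; rewrite !mxE.
  by rewrite !row'M h2.
Qed.

Lemma alternate_mulmxr k m N (w : 'M[R]_(k, N) -> R) (A : 'M[R]_(m, N)) :
  alternate w -> alternate (fun v => w (v *m A)).
Proof.
move=> [mw aw]; split; first exact: multilinear_mulmxr.
by move=> v j1 j2 j12 hj; apply: aw j12 _; rewrite !row_mul hj.
Qed.

Lemma multilinear_expand k m N (w : 'M[R]_(k, N) -> R) (C : 'M[R]_(k, m))
    (v : 'M[R]_(m, N)) : multilinear w ->
  w (C *m v) =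
  \sum_(f : {ffun 'I_k -> 'I_m}) (\prod_j C j (f j)) * w (rowsub f v).
Proof.
move=> mw.
have mp : multilinear (fun C' : 'M[R]_(k, m) => \sum_(f : {ffun 'I_k -> 'I_m})
    (\prod_j C' j (f j)) * w (rowsub f v)).
  by apply: multilinear_lin => f _; apply: multilinear_prod.
apply: (multilinear_eq (multilinear_mulmxr v mw) mp _ C) => g.
rewrite (bigD1 (finfun g))//= [X in _ = _ + X]big1 ?addr0 => [|f fg].
  rewrite big1 ?mul1r => [|j _]; last by rewrite basis_rowsE ffunE eqxx.
  congr w; rewrite /basis_rows mul_rowsub_mx mul1mx.
  by apply/matrixP => i l; rewrite !mxE ffunE.
suff /existsP[j fj] : [exists j, g j != f j].
  by rewrite (bigD1 j)//= basis_rowsE (negPf fj) !mul0r.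
rewrite -negb_forall; apply: contra fg => /forallP gf.
by apply/eqP/ffunP => j; rewrite ffunE (eqP (gf j)).
Qed.

Lemma multilinear_coord k N (w : 'M[R]_(k, N) -> R) v : multilinear w ->
  w v = \sum_(f : {ffun 'I_k -> 'I_N}) (\prod_j v j (f j)) * w (basis_rows f).
Proof. by move=> mw; rewrite -[in LHS](mulmx1 v) multilinear_expand. Qed.

Lemma alternate_xrow k N (w : 'M[R]_(k, N) -> R) i j v :
  alternate w -> i != j -> w (xrow i j v) = - w v.
Proof.
move=> [mw aw] ij.
pose F r s := w (setrow i r (setrow j s v)).
have Fl a b s : F (a + b) s = F a s + F b s.
  by have := multilinear_setrow i (setrow j s v) 1 1 a b mw; rewrite !scale1r !mul1r.
have swap r s : setrow i r (setrow j s v) = setrow j s (setrow i r v).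
  apply/matrixP => x y; rewrite !mxE; case: (eqVneq x i) => // ->.
  by rewrite (negPf ij).
have Fr a b s : F s (a + b) = F s a + F s b.
  have := multilinear_setrow j (setrow i s v) 1 1 a b mw.
  by rewrite !scale1r !mul1r /F !swap.
have F0 r : F r r = 0.
  apply: (aw _ i j ij); apply/row_eqP => l.
  by rewrite 3!mxE !eqxx eq_sym (negPf ij) mxE eqxx.
have := F0 (row i v + row j v); rewrite Fl !Fr !F0 add0r addr0.
have -> : F (row i v) (row j v) = w v.
  by rewrite /F setrow_id setrow_id.
have -> : F (row j v) (row i v) = w (xrow i j v).
  congr w; apply/matrixP => x y; rewrite !mxE.
  case: (eqVneq x i) => [->|xi]; first by rewrite tpermL.
  case: (eqVneq x j) => [->|xj]; first by rewrite tpermR.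
  by rewrite tpermD// eq_sym.
by move=> h; apply/eqP; rewrite -addr_eq0 addrC h.
Qed.

Lemma alternate_row_perm k N (w : 'M[R]_(k, N) -> R) (s : 'S_k) v :
  alternate w -> w (row_perm s v) = (-1) ^+ s * w v.
Proof.
move=> aw; case: (prod_tpermP s) => ts -> {s}.
elim: ts v => [|t ts IHts] v /=.
  by move=> _; rewrite big_nil row_perm1 odd_perm1 expr0 mul1r.
move=> /andP[t12 /IHts{}IHts].
rewrite big_cons row_permM -/(xrow _ _ _) alternate_xrow// IHts.
by rewrite odd_permM odd_tperm t12 signrN mulNr.
Qed.

Lemma alternate_basis_noninj k N (w : 'M[R]_(k, N) -> R) m (f : 'I_k -> 'I_m) v :
  alternate w -> ~~ injectiveb f -> w (rowsub f v) = 0.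
Proof.
move=> [_ aw] /injectivePn[i [j ij fij]]; apply: (aw _ i j) => //.
by apply/row_eqP => l; rewrite !mxE fij.
Qed.

(** The sum runs over all maps [f], not only increasing ones: each permutation in the Leibniz
    formula contributes one copy of [w v], whence the factorial. *)
Lemma alternate_coord k N (w : 'M[R]_(k, N) -> R) v : alternate w ->
  k`!%:R * w v =
  \sum_(f : {ffun 'I_k -> 'I_N}) w (basis_rows f) * \det (colsub f v).
Proof.
move=> aw.
under eq_bigr do rewrite /determinant mulr_sumr.
rewrite exchange_big /=.
transitivity (\sum_(s : 'S_k) w v); last first.
  apply: eq_bigr => s _; rewrite (multilinear_coord v aw.1).
  pose h (f : {ffun 'I_k -> 'I_N}) := [ffun i => f (s i)].
  rewrite (reindex h) /=; last first.
    exists (fun f => [ffun i => f (s^-1%g i)]) => f _; apply/ffunP => i; rewrite !ffunE.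
      by rewrite permKV.
    by rewrite permK.
  apply: eq_bigr => f _; rewrite mulrC.
  have -> : basis_rows (h f) = row_perm s (basis_rows f).
    by apply/matrixP => i l; rewrite !mxE ffunE.
  rewrite alternate_row_perm// -mulrA [RHS]mulrCA; congr (_ * (_ * _)).
  by apply: eq_bigr => i _; rewrite !mxE ffunE.
by rewrite sumr_const card_Sn mulr_natl.
Qed.

(** The sum is the Euclidean inner product of $k$-tensors, which can be computed in any orthonormal
    basis, here the rows of [Q]. *)
Lemma contraction_orthogonal k N (D w : 'M[R]_(k, N) -> R) (Q : 'M[R]_N) :
  multilinear D -> multilinear w -> Q^T *m Q = 1%:M ->
  \sum_(f : {ffun 'I_k -> 'I_N}) D (rowsub f Q) * w (rowsub f Q) =
  \sum_(f : {ffun 'I_k -> 'I_N}) D (basis_rows f) * w (basis_rows f).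
Proof.
move=> mD mw QQ.
transitivity (\sum_(f : {ffun 'I_k -> 'I_N}) \sum_(g : {ffun 'I_k -> 'I_N})
   \sum_(h : {ffun 'I_k -> 'I_N})
   (\prod_j (Q (f j) (g j) * Q (f j) (h j))) * (D (basis_rows g) * w (basis_rows h))).
  apply: eq_bigr => f _.
  rewrite (multilinear_coord _ mD) (multilinear_coord _ mw) mulr_suml.
  apply: eq_bigr => g _; rewrite mulr_sumr; apply: eq_bigr => h _.
  rewrite big_split /= mulrACA; congr (_ * _ * _);
    by apply: eq_bigr => j _; rewrite !mxE.
rewrite exchange_big /=; apply: eq_bigr => g _.
rewrite exchange_big /= (bigD1 g)//= [X in _ + X]big1 ?addr0.
  rewrite -mulr_suml -(bigA_distr_bigA (fun j i => Q i (g j) * Q i (g j))) /=.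
  rewrite big1 ?mul1r// => j _; transitivity ((Q^T *m Q) (g j) (g j)).
    by rewrite mxE; apply: eq_bigr => i _; rewrite mxE.
  by rewrite QQ mxE eqxx.
move=> h hg; rewrite -mulr_suml.
rewrite -(bigA_distr_bigA (fun j i => Q i (g j) * Q i (h j))) /=.
suff /existsP[j hj] : [exists j, h j != g j].
  rewrite (bigD1 j)//= (_ : \sum_i _ = 0) ?mul0r//.
  transitivity ((Q^T *m Q) (g j) (h j)).
    by rewrite mxE; apply: eq_bigr => i _; rewrite mxE.
  by rewrite QQ mxE eq_sym (negPf hj).
rewrite -negb_forall; apply: contra hg => /forallP gf.
by apply/eqP/ffunP => j; rewrite (eqP (gf j)).
Qed.

(** In the basis [Q] only the rearrangements of [c] survive. They number $k!$ and contribute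
    equally, since the sign of a permutation enters twice. *)
Lemma contraction_frame k N (D w : 'M[R]_(k, N) -> R) (Q : 'M[R]_N)
    (c : 'I_k -> 'I_N) :
  alternate D -> alternate w -> Q^T *m Q = 1%:M -> injective c ->
  (forall (f : 'I_k -> 'I_N) j, f j \notin codom c -> D (rowsub f Q) = 0) ->
  \sum_(f : {ffun 'I_k -> 'I_N}) D (basis_rows f) * w (basis_rows f) =
  k`!%:R * (D (rowsub c Q) * w (rowsub c Q)).
Proof.
move=> aD aw QQ ci Dc; rewrite -(contraction_orthogonal aD.1 aw.1 QQ).
pose cs (s : 'S_k) : {ffun 'I_k -> 'I_N} := [ffun j => c (s j)].
rewrite (bigID (mem (cs @: predT))) /= [X in _ + X]big1 ?addr0; last first.
  move=> f fc; have [fi|/(alternate_basis_noninj Q aD)->] := boolP (injectiveb f);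
    last by rewrite mul0r.
  have [/existsP[j /Dc->]|] := boolP [exists j, f j \notin codom c].
    by rewrite mul0r.
  rewrite negb_exists => /forallP fcc; case/negP: fc.
  have fE j : {i | f j = c i}.
    by have := fcc j; rewrite negbK => /codomP/cid[i ->]; exists i.
  pose s j := projT1 (fE j).
  have si : injective s.
    move=> i j sij; apply: (injectiveP _ fi).
    by rewrite (projT2 (fE i)) (projT2 (fE j)) -!/(s _) sij.
  apply/imsetP; exists (perm si) => //; apply/ffunP => j; rewrite ffunE permE.
  exact: projT2 (fE j).
transitivity (\sum_(s : 'S_k) D (rowsub c Q) * w (rowsub c Q)); last first.
  by rewrite sumr_const card_Sn mulr_natl.
have csi : injective cs.
  move=> s t /ffunP st; apply/permP => j; apply: ci.
  by have := st j; rewrite !ffunE.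
rewrite big_imset /=; last by move=> s t _ _; apply: csi.
apply: eq_bigr => s _.
have -> : rowsub (cs s) Q = row_perm s (rowsub c Q).
  by apply/matrixP => i l; rewrite !mxE ffunE.
rewrite !alternate_row_perm// mulrACA -signr_addb.
by rewrite addbb mul1r.
Qed.
End Alternating.

Lemma alternate_det (R : numFieldType) N :
  alternate (fun v : 'M[R]_N => \det v).
Proof.
split=> [v v1 v2 j a b hj h1 h2|v j1 j2 j12 hj].
  by apply: (@determinant_multilinear _ _ v v1 v2 j) => //; rewrite ?h1 ?h2.
apply: (determinant_alternate j12) => l.
by have /row_eqP := hj; apply.
Qed.

(** [F v] fills the slots [c] with the rows of [v] and keeps the other slots fixed; this covers both
    partial determinants and interior products. *)
Lemma alternate_place (R : numFieldType) p q N (w : 'M[R]_(q, N) -> R)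
    (F : 'M[R]_(p, N) -> 'M[R]_(q, N)) (c : 'I_p -> 'I_q) :
  alternate w -> injective c ->
  (forall v j l, F v (c j) l = v j l) ->
  (forall v v' i l, i \notin codom c -> F v i l = F v' i l) ->
  alternate (fun v => w (F v)).
Proof.
move=> [mw aw] ci Fc Fn; split=> [v v1 v2 j a b /rowP hj h1 h2|v j1 j2 j12 hj].
  have Frow' u : row' j u = row' j v -> row' (c j) (F u) = row' (c j) (F v).
    move=> h; apply/matrixP => i l; rewrite !mxE.
    have [/codomP[i' ii']|/Fn//] := boolP (lift (c j) i \in codom c).
    rewrite ii' !Fc; apply: (row_row'P h).
    by apply/eqP => i'j; move: (neq_lift (c j) i); rewrite ii' i'j eqxx.
  apply: (mw _ _ _ (c j)); [|exact: Frow'|exact: Frow'].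
  by apply/rowP => l; have := hj l; rewrite !mxE !Fc.
apply: (aw _ (c j1) (c j2)); first by rewrite (inj_eq ci).
by apply/row_eqP => l; rewrite !Fc; have /row_eqP := hj; apply.
Qed.

(** * The Euclidean Hodge star through determinants *)

Section Star.
Variables (R : numFieldType) (N p q : nat) (pos : 'I_N -> 'I_p + 'I_q)
  (ipos : 'I_p + 'I_q -> 'I_N).
Hypotheses (posK : cancel pos ipos) (iposK : cancel ipos pos).

(** [pos] tells from which block each row of the determinant comes, so a choice of row order takes
    the place of explicit shuffle signs. *)
Definition mix (A : 'M[R]_(p, N)) (B : 'M[R]_(q, N)) : 'M[R]_N :=
  \matrix_(i, l) match pos i with inl a => A a l | inr b => B b l end.

Lemma mix_inl A B a l : mix A B (ipos (inl a)) l = A a l.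
Proof. by rewrite mxE iposK. Qed.

Lemma mix_inr A B b l : mix A B (ipos (inr b)) l = B b l.
Proof. by rewrite mxE iposK. Qed.

Lemma ipos_inj : injective ipos.
Proof. exact: can_inj iposK. Qed.

Lemma mix_mulmx A B (Q : 'M[R]_N) : mix A B *m Q = mix (A *m Q) (B *m Q).
Proof.
apply/matrixP => i l; rewrite [RHS]mxE [LHS]mxE.
by case E: (pos i) => [a|b]; rewrite mxE; apply: eq_bigr => j _; rewrite mxE E.
Qed.

Lemma mix_rowsub (Q : 'M[R]_N) :
  mix (rowsub (fun a => ipos (inl a)) Q) (rowsub (fun b => ipos (inr b)) Q) = Q.
Proof.
apply/matrixP => i l; rewrite mxE.
by case E: (pos i) => [a|b]; rewrite !mxE -E posK.
Qed.

Lemma alternate_mixl B : alternate (fun A => \det (mix A B)).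
Proof.
apply: (@alternate_place _ _ _ _ (fun v => \det v) (mix^~ B) (fun a => ipos (inl a))).
- exact: alternate_det.
- by move=> a a' /ipos_inj[].
- by move=> v j l; rewrite mix_inl.
- move=> v v' i l; rewrite !mxE; case E: (pos i) => [a|b]// /negP[].
  by apply/codomP; exists a; rewrite -E posK.
Qed.

Lemma alternate_mixr A : alternate (fun B => \det (mix A B)).
Proof.
apply: (@alternate_place _ _ _ _ (fun v => \det v) (mix A) (fun b => ipos (inr b))).
- exact: alternate_det.
- by move=> a a' /ipos_inj[].
- by move=> v j l; rewrite mix_inr.
- move=> v v' i l; rewrite !mxE; case E: (pos i) => [a|b]// /negP[].
  by apply/codomP; exists b; rewrite -E posK.
Qed.

(* The Euclidean Hodge star, up to the sign of the shuffle [pos]. *)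
Definition star (w : 'M[R]_(p, N) -> R) (B : 'M[R]_(q, N)) : R :=
  \sum_(f : {ffun 'I_p -> 'I_N}) \det (mix (basis_rows R f) B)
     * ((p`!%:R)^-1 * w (basis_rows R f)).

Lemma alternate_star w : alternate (star w).
Proof. by apply: alternate_lin => f _; apply: alternate_mixr. Qed.

Lemma star_sum w B : star w B = (p`!%:R)^-1 *
  \sum_(f : {ffun 'I_p -> 'I_N}) \det (mix (basis_rows R f) B) * w (basis_rows R f).
Proof. by rewrite mulr_sumr; apply: eq_bigr => f _; rewrite mulrCA. Qed.

(** Computed in the basis [Q], a term that picks a row of the second block repeats that row and has
    zero determinant; the remaining ones give [\det Q = 1]. *)
Lemma star_frame w (Q : 'M[R]_N) : alternate w -> Q^T *m Q = 1%:M -> \det Q = 1 ->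
  star w (rowsub (fun b => ipos (inr b)) Q) = w (rowsub (fun a => ipos (inl a)) Q).
Proof.
move=> aw QQ dQ; rewrite star_sum.
rewrite (contraction_frame (alternate_mixl _) aw QQ (c := fun a => ipos (inl a))).
- by rewrite mix_rowsub dQ mul1r mulKf// pnatr_eq0 -lt0n fact_gt0.
- by move=> a a' /ipos_inj[].
- move=> f j fj; apply: (determinant_alternate (i1 := ipos (inl j)) (i2 := f j)).
    by apply: contraNneq fj => <-; apply/codomP; exists j.
  move=> l; rewrite mix_inl mxE.
  case E: (pos (f j)) => [a|b].
    by case/negP: fj; apply/codomP; exists a; rewrite -E posK.
  by rewrite [RHS]mxE E mxE -E posK.
Qed.

(** For a reflection the factor [\det Q] is $-1$; this is what exchanges the parities. *)
Lemma star_mulmxr w (Q : 'M[R]_N) B : alternate w -> Q^T *m Q = 1%:M ->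
  star w (B *m Q) = \det Q * star (fun A => w (A *m Q)) B.
Proof.
move=> aw QQ; rewrite !star_sum mulrCA; congr (_ * _).
rewrite -(contraction_orthogonal (alternate_mixl _).1 aw.1 QQ) mulr_sumr.
apply: eq_bigr => f _.
have -> : rowsub f Q = basis_rows R f *m Q by rewrite mul_rowsub_mx mul1mx.
by rewrite -mix_mulmx det_mulmx mulrA [X in X * _]mulrC.
Qed.

End Star.

(** * Jacobians of [Phi] and of the reflections *)

Section Jacobians.
Import numFieldNormedType.Exports.
Variables (R : realType) (n : nat).
Local Notation V := 'rV[R]_n.+1.

Lemma is_diff_coord (u : V) i : is_diff u (fun x : V => x 0 i) (fun x : V => x 0 i).
Proof.
have @f : {linear V -> R}.
  by exists (fun x : V => x 0 i); do 2![eexists]; do ?[constructor];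
     rewrite ?mxE// => ? *; rewrite ?mxE//; move=> ?; rewrite !mxE.
apply: DiffDef; first exact: differentiable_coord.
rewrite (_ : (fun _ => _) = f) // diff_lin//; exact: coord_continuous.
Qed.

(** Both [Phi] and the reflections act on each coordinate separately, so their Jacobians are
    diagonal and one computation serves both. *)
Lemma jacobian_coordwise (f : V -> V) (u d : V) (k : 'I_n.+1 -> V -> R) :
  (forall x i, f x 0 i = k i x) ->
  (forall i, is_diff u (k i) (fun x => d 0 i * x 0 i)) ->
  jacobian f u = diag_mx d.
Proof.
move=> fk dk.
have sumd (s : seq 'I_n.+1) :
    is_diff u (fun x : V => \sum_(i <- s) k i x *: (delta_mx 0 i : V))
      (fun x : V => \sum_(i <- s) (d 0 i * x 0 i) *: (delta_mx 0 i : V)).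
  elim: s => [|i s IHs].
    have -> : (fun x : V => \sum_(i <- [::]) k i x *: (delta_mx 0 i : V)) = cst 0.
      by apply/funext => x; rewrite big_nil.
    have -> : (fun x : V => \sum_(i <- [::]) (d 0 i * x 0 i) *: (delta_mx 0 i : V)) = 0.
      by apply/funext => x; rewrite big_nil.
    exact: is_diff_cst.
  have -> : (fun x : V => \sum_(j <- i :: s) k j x *: (delta_mx 0 j : V)) =
      (fun x : V => k i x *: (delta_mx 0 i : V)) +
      (fun x : V => \sum_(i <- s) k i x *: (delta_mx 0 i : V)).
    by apply/funext => x; rewrite big_cons.
  have -> : (fun x : V => \sum_(j <- i :: s) (d 0 j * x 0 j) *: (delta_mx 0 j : V)) =
      (fun x : V => (d 0 i * x 0 i) *: (delta_mx 0 i : V)) +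
      (fun x : V => \sum_(i <- s) (d 0 i * x 0 i) *: (delta_mx 0 i : V)).
    by apply/funext => x; rewrite big_cons.
  apply: is_diffD; apply: DiffDef.
    by apply: differentiableZl; have := dk i => /@ex_diff.
  rewrite diffZl; last by have := dk i => /@ex_diff.
  by have [_ ->] := dk i.
have fE : f = (fun x : V => \sum_i k i x *: (delta_mx 0 i : V)).
  apply/funext => x; rewrite [LHS]row_sum_delta; apply: eq_bigr => i _.
  by rewrite fk.
apply/row_matrixP => i; rewrite !rowE mul_rV_lin1 fE.
have [_ ->] := sumd (index_enum _); apply/rowP => j.
rewrite summxE (bigD1 j)//= big1 ?addr0 => [|l lj]; last first.
  by rewrite !mxE [j == l]eq_sym (negPf lj) andbF mulr0.
rewrite -rowE !mxE !eqxx mulr1 [j == i]eq_sym.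
by case: (eqVneq i j) => [->|_]; rewrite ?mulr1 ?mulr0.
Qed.

Lemma jacobian_Phi (u : V) : jacobian Phi u = diag_mx (2 *: u).
Proof.
apply: (@jacobian_coordwise _ _ _ (fun i x => x 0 i * x 0 i)) => [x i|i].
  by rewrite mxE expr2.
have c := is_diff_coord u i.
have -> : (fun x : V => (2 *: u) 0 i * x 0 i) = u 0 i *: (fun x : V => x 0 i : R)
    + u 0 i *: (fun x : V => x 0 i : R).
  by apply/funext => x; rewrite !mxE mulr_natl mulr2n mulrDl.
exact: (is_diffM c c).
Qed.

Definition reflection_diag (i : 'I_n.+1) : V := \row_j (-1) ^+ (j == i).

Lemma jacobian_reflection i (u : V) :
  jacobian (reflection i) u = diag_mx (reflection_diag i).
Proof.
apply: (@jacobian_coordwise _ _ _ (fun j x => reflection_diag i 0 j *: (x 0 j : R))) => [x j|j].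
  by rewrite !mxE; case: eqP => _ /=; rewrite ?expr1 ?expr0 ?scaleN1r ?scale1r.
exact: (is_diffZ _ (is_diff_coord u j)).
Qed.

Lemma reflection_mulmx i (u : V) : reflection i u = u *m diag_mx (reflection_diag i).
Proof.
apply/rowP => j; rewrite mul_mx_diag !mxE.
by case: eqP => _ /=; rewrite ?expr1 ?expr0 ?mulrN1 ?mulr1.
Qed.
End Jacobians.

Lemma basis_rows_mul_diag (R : numFieldType) k N (f : 'I_k -> 'I_N) (d : 'rV[R]_N) :
  basis_rows R f *m diag_mx d = diag_mx (\row_j d 0 (f j)) *m basis_rows R f.
Proof.
rewrite mul_mx_diag mul_diag_mx; apply/matrixP => i l; rewrite !mxE mulrC.
by case: eqVneq => [->|_]; rewrite ?mulr0.
Qed.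

Lemma multilinear_diag (R : numFieldType) k N (w : 'M[R]_(k, N) -> R) (d : 'rV[R]_k) v :
  multilinear w -> w (diag_mx d *m v) = (\prod_j d 0 j) * w v.
Proof.
move=> mw; rewrite multilinear_expand// (bigD1 [ffun j => j])//= [X in _ + X]big1 ?addr0.
  congr (_ * w _); first by apply: eq_bigr => j _; rewrite ffunE mxE eqxx.
  by apply/matrixP => i l; rewrite mxE ffunE.
move=> f fid; suff /existsP[j fj] : [exists j, j != f j].
  by rewrite (bigD1 j)//= mxE (negPf fj) !mul0r.
rewrite -negb_forall; apply: contra fid => /forallP h.
by apply/eqP/ffunP => j; rewrite ffunE -(eqP (h j)).
Qed.

(** * Polynomial forms on $\mathbb R^{n+1}$, their pullback under [Phi] and their parity *)

Section PolynomialForms.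
Variables (R : realType) (n : nat).
Local Notation N := n.+1.
Local Notation V := 'rV[R]_N.
Implicit Types (D : multinom N -> Prop).

Definition forms D k (w : kform R n k) : Prop :=
  (forall x, alternate (w x)) /\ forall v, polyfun D (w^~ v).

Lemma is_kform_euclidean k (w : kform R n k) :
  is_kform (euclidean R n) w <-> forall u, alternate (w u).
Proof.
split=> [[_ mw aw] u|aw].
  by split=> [v v1 v2 j a b|v j1 j2]; [apply: mw|apply: aw].
split=> [u v []//|u v v1 v2 j a b _ _ _|u v j1 j2 _].
  exact: (aw u).1.
exact: (aw u).2.
Qed.

Lemma poly_formsE r k (w : kform R n k) : poly_forms r w <-> forms (deg_le r) w.
Proof.
have E (i : 'I_k -> 'I_N) :
    (\matrix_(j < k) delta_mx 0 (i j) : 'M[R]_(k, N)) = basis_rows R i.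
  by apply/matrixP => j l; rewrite !mxE eqxx eq_sym.
split=> [[/is_kform_euclidean aw pw]|[aw pw]]; split=> //.
- move=> v; apply: (eq_polyfun (D := deg_le r)
    (f := fun x => \sum_(f : {ffun 'I_k -> 'I_N})
             (\prod_j v j (f j)) * w x (basis_rows R f))) => // [x|].
    by rewrite (multilinear_coord v (aw x).1).
  apply: polyfun_sum => f _; apply: polyfunZ.
  by have [p [dp wp]] := pw f; exists p; split=> // x; rewrite -E wp.
- exact/is_kform_euclidean.
- by move=> i; have [p [dp wp]] := pw (basis_rows R i); exists p; split=> // x; rewrite E wp.
Qed.

Lemma formsDZ D k a b (w1 w2 : kform R n k) : forms D w1 -> forms D w2 ->
  forms D (fun x v => a * w1 x v + b * w2 x v).
Proof.
move=> [a1 p1] [a2 p2]; split=> [x|v]; last exact: polyfunDZ.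
split=> [v v1 v2 j c d h h1 h2|v j1 j2 j12 h].
  by rewrite ((a1 x).1 _ _ _ _ _ _ h h1 h2) ((a2 x).1 _ _ _ _ _ _ h h1 h2); ring.
by rewrite ((a1 x).2 _ _ _ j12 h) ((a2 x).2 _ _ _ j12 h) !mulr0 addr0.
Qed.

Lemma forms_sub D D' k (w : kform R n k) :
  (forall m, D m -> D' m) -> forms D w -> forms D' w.
Proof. by move=> DD' [aw pw]; split=> // v; apply: eq_polyfun (pw v). Qed.

Lemma forms_neg D k (w : kform R n k) : (forall m, ~ D m) -> forms D w -> w = fun _ _ => 0.
Proof.
move=> D0 [_ pw]; apply/funext => x; apply/funext => v.
have [p [dp ->]] := pw v; suff -> : p = 0 by rewrite /ev meval0.
by apply/mpolyP => m; rewrite mcoeff0; apply: contrapT => /eqP /dp /D0.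
Qed.

(** Coefficients indexed by all maps [f] do not make the form alternating by themselves. Each use
    proves alternation where some nonzero polynomial does not vanish, and extends it by density. *)
Lemma forms_of_coefs D k (g : {ffun 'I_k -> 'I_N} -> V -> R) :
  (forall f, polyfun D (g f)) ->
  (forall v : 'M[R]_(k, N), forall j1 j2, j1 != j2 -> row j1 v = row j2 v ->
     forall x, \sum_(f : {ffun 'I_k -> 'I_N}) (\prod_j v j (f j)) * g f x = 0) ->
  forms D (fun x (v : 'M[R]_(k, N)) => \sum_(f : {ffun 'I_k -> 'I_N}) (\prod_j v j (f j)) * g f x).
Proof.
move=> pg ag; split=> [x|v]; last by apply: polyfun_sum => f _; apply: polyfunZ.
split; last by move=> v j1 j2 j12 h; apply: (ag _ j1 j2).
by apply: multilinear_lin => f _; apply: multilinear_prod.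
Qed.

(** Although [Phi] only reaches the nonnegative orthant, doubling exponents keeps distinct monomials
    distinct, so independence applies. *)
Lemma polyfun_Phi_eq0 D (f : V -> R) : polyfun D f -> (forall u, f (Phi u) = 0) ->
  forall x, f x = 0.
Proof.
move=> [p [_ fp]] f0 x; rewrite fp.
have mhalfK (m : multinom N) : mhalf (mdouble m) = m.
  by apply/mnmP => i; rewrite !mnmE addnn doubleK.
have p0 m : m \in msupp p -> mcoeff m p = 0.
  move=> mp; rewrite -[m]mhalfK.
  apply: (@monom_free _ _ [seq mdouble m | m <- msupp p] (fun m => mcoeff (mhalf m) p)).
  - by rewrite map_inj_uniq ?msupp_uniq//; apply: (can_inj mhalfK).
  - move=> u; rewrite big_map -[RHS](f0 u) fp evE; apply: eq_bigr => m' _.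
    by rewrite mhalfK monom_Phi.
  - exact: map_f.
by rewrite evE big_seq big1// => m /p0->; rewrite mul0r.
Qed.

Lemma polyfun_one : polyfun (fun m => m = mnm0) (fun _ : V => 1 : R).
Proof.
apply: (eq_polyfun (f := monom mnm0) (D := fun m => m = mnm0)) => // [x|].
  by rewrite /monom big1// => i _; rewrite mnmE.
exact: polyfun_monom.
Qed.

Lemma polyfun_uN : polyfun (fun=> True) (@uN R n).
Proof.
apply: (eq_polyfun (f := fun x : V => uN x * 1) (D := fun=> True)) => // [x|].
  exact: mulr1.
exact: (polyfunM_uN (D := fun m => m = mnm0) _ polyfun_one).
Qed.

Lemma uN_const1 : uN (const_mx 1 : V) != 0.
Proof. by rewrite /uN big1 ?oner_neq0// => i _; rewrite mxE. Qed.

Lemma polyfun_sumx : polyfun (fun=> True) (fun x : V => \sum_i x 0 i).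
Proof.
apply: polyfun_sum => i _.
apply: (eq_polyfun (f := monom (mnm1 i)) (D := fun=> True)) => // [x|].
  exact: monom1.
exact: polyfun_monom.
Qed.

Lemma sumx_neq0 : \sum_i (delta_mx 0 0 : V) 0 i != 0.
Proof.
by rewrite (bigD1 0)//= big1 => [|i /negPf i0]; rewrite mxE ?i0// eqxx addr0 oner_neq0.
Qed.

Lemma forms_homogenize d k (w : kform R n k) : forms (deg_le d%:Z) w ->
  exists2 w', forms (deg_eq d%:Z) w' &
    forall (x : V) v, \sum_i x 0 i = 1 -> w' x v = w x v.
Proof.
move=> [aw pw].
have /choice [g hg] : forall f : {ffun 'I_k -> 'I_N}, exists g : V -> R,
    polyfun (deg_eq d%:Z) g /\ forall x : V, \sum_i x 0 i != 0 ->
      g x = (\sum_i x 0 i) ^+ d * w ((\sum_i x 0 i)^-1 *: x) (basis_rows R f).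
  by move=> f; have [g ? ?] := homogenize (pw (basis_rows R f)); exists g.
have gw (x : V) (v : 'M[R]_(k, N)) : \sum_i x 0 i != 0 ->
    \sum_(f : {ffun 'I_k -> 'I_N}) (\prod_j v j (f j)) * g f x =
    (\sum_i x 0 i) ^+ d * w ((\sum_i x 0 i)^-1 *: x) v.
  move=> x0; rewrite (multilinear_coord v (aw _).1) mulr_sumr.
  by apply: eq_bigr => f _; rewrite (hg f).2// mulrCA.
exists (fun x (v : 'M[R]_(k, N)) => \sum_(f : {ffun 'I_k -> 'I_N}) (\prod_j v j (f j)) * g f x); last first.
  by move=> x v x1; rewrite gw x1 ?oner_neq0// invr1 expr1n mul1r scale1r.
apply: forms_of_coefs => [f|v j1 j2 j12 h]; first by have [] := hg f.
apply: (@polyfun_mul_eq0 _ _ (deg_eq d%:Z) (fun=> True) _ (fun x : V => \sum_i x 0 i)).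
- by apply: polyfun_sum => f _; apply: polyfunZ; have [] := hg f.
- exact: polyfun_sumx.
- move=> x; have [->|x0] := eqVneq (\sum_i x 0 i) 0; first by rewrite mulr0.
  by rewrite gw// ((aw _).2 _ _ _ j12 h) mulr0 mul0r.
- by exists (delta_mx 0 0); apply: sumx_neq0.
Qed.

Lemma forms_divide_uN D D' k (w : kform R n k) : forms D w ->
  (forall i (x : V) v, x 0 i = 0 -> w x v = 0) ->
  (forall m, D m -> (forall i, (0 < m i)%N) -> D' (mpred m)) ->
  exists2 w', forms D' w' & forall x v, w x v = uN x * w' x v.
Proof.
move=> [aw pw] w0 DD'.
have /choice [g hg] : forall f : {ffun 'I_k -> 'I_N}, exists g : V -> R,
    polyfun D' g /\ forall x, w x (basis_rows R f) = uN x * g x.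
  move=> f; have [|g ? ?] := divide_uN (pw (basis_rows R f)) _ DD'; last by exists g.
  by move=> i x; apply: w0.
have gw (x : V) (v : 'M[R]_(k, N)) : w x v = uN x * \sum_(f : {ffun 'I_k -> 'I_N}) (\prod_j v j (f j)) * g f x.
  rewrite (multilinear_coord v (aw _).1) mulr_sumr.
  by apply: eq_bigr => f _; rewrite (hg f).2// mulrCA.
exists (fun x (v : 'M[R]_(k, N)) => \sum_(f : {ffun 'I_k -> 'I_N}) (\prod_j v j (f j)) * g f x) => //.
apply: forms_of_coefs => [f|v j1 j2 j12 h]; first by have [] := hg f.
apply: (@polyfun_mul_eq0 _ _ D' (fun=> True) _ (@uN R n)).
- by apply: polyfun_sum => f _; apply: polyfunZ; have [] := hg f.
- exact: polyfun_uN.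
- by move=> x; rewrite mulrC -gw; apply: (aw _).2 j12 h.
- by exists (const_mx 1); apply: uN_const1.
Qed.

Lemma forms_uN D D' k (w : kform R n k) :
  (forall m, D m -> D' (mnm_add (mindic finset.setT) m)) ->
  forms D w -> forms D' (fun x v => uN x * w x v).
Proof.
move=> DD' [aw pw]; split=> [x|v]; last exact: polyfunM_uN (pw v).
have [m a] := aw x; split=> [v v1 v2 j c d h h1 h2|v j1 j2 j12 h].
  by rewrite (m _ _ _ _ _ _ h h1 h2); ring.
by rewrite (a _ _ _ j12 h) mulr0.
Qed.

(** Pullback under [Phi] on the whole space, with the Jacobian $\mathrm{diag}(2u)$ written out. *)
Definition phis k (w : kform R n k) : kform R n k :=
  fun u v => w (Phi u) (v *m diag_mx (2 *: u)).

Definition refl i k (w : kform R n k) : kform R n k :=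
  fun u v => w (reflection i u) (v *m diag_mx (reflection_diag R i)).

Definition parity (eps : R) k (w : kform R n k) : Prop :=
  forall i u v, refl i w u v = eps * w u v.

Lemma reflectionK i (u : V) : reflection i (reflection i u) = u.
Proof. by apply/rowP => j; rewrite !mxE; case: eqP; rewrite ?opprK. Qed.

Lemma reflection_diagK i : diag_mx (reflection_diag R i) *m diag_mx (reflection_diag R i)
  = 1%:M :> 'M[R]_N.
Proof.
rewrite mul_diag_mx; apply/matrixP => a b; rewrite !mxE.
case: (eqVneq a b) => [->|_]; last by rewrite mulr0.
by rewrite !mulr1n -expr2 sqrr_sign.
Qed.

Lemma reflK i k (w : kform R n k) u v : refl i (refl i w) u v = w u v.
Proof. by rewrite /refl reflectionK -mulmxA reflection_diagK mulmx1. Qed.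

Lemma reflC i j k (w : kform R n k) u v : refl i (refl j w) u v = refl j (refl i w) u v.
Proof.
rewrite /refl -!mulmxA diag_mxC; congr (w _ _).
by apply/rowP => l; rewrite !mxE; do 2 case: eqP.
Qed.

Lemma forms_refl D i k (w : kform R n k) : forms D w -> forms D (refl i w).
Proof.
move=> [aw pw]; split=> [x|v]; first exact: alternate_mulmxr.
exact: polyfun_reflection (pw _).
Qed.

Lemma phis_parity k (w : kform R n k) : parity 1 (phis w).
Proof.
move=> i u v; rewrite mul1r /refl /phis.
have -> : Phi (reflection i u) = Phi u.
  by apply/rowP => j; rewrite !mxE; case: eqP => _; rewrite ?sqrrN.
rewrite -mulmxA; have -> // : diag_mx (reflection_diag R i) *m
  diag_mx (2 *: reflection i u) = diag_mx (2 *: u).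
rewrite mul_diag_mx; apply/matrixP => a b; rewrite !mxE.
case: (eqVneq a b) => [->|_]; last by rewrite mulr0.
rewrite !mulr1n.
by case: eqP => _ /=; rewrite ?expr1 ?expr0 ?mul1r ?mulN1r ?mulrN ?opprK.
Qed.

Lemma prod_coord_monom k (f : 'I_k -> 'I_N) :
  exists2 m, mdeg m = k & forall x : V, monom m x = \prod_j x 0 (f j).
Proof.
exists (\big[@mnm_add N/@mnm0 N]_j mnm1 (f j)).
  rewrite (big_morph _ (@mdegD N) (@mdeg0 N)).
  under eq_bigr do rewrite mdeg1.
  by rewrite sum1_card card_ord.
move=> x; rewrite (big_morph (fun m => monom m x) (id1 := 1) (op1 := *%R)).
- by apply: eq_bigr => j _; rewrite monom1.
- by move=> m m'; rewrite monomD.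
- by rewrite /monom big1// => i _; rewrite mnmE.
Qed.

(** In coordinates $\Phi^*dx_f=2^k\prod_j u_{f(j)}\,du_f$. Coefficient degrees are doubled and then
    raised by $k$, the source of $2r+k$. *)
Lemma phis_coord k (w : kform R n k) u v : multilinear (w (Phi u)) ->
  phis w u v = \sum_(f : {ffun 'I_k -> 'I_N})
    (2 ^+ k * \prod_j v j (f j)) * (\prod_j u 0 (f j) * w (Phi u) (basis_rows R f)).
Proof.
move=> mw; rewrite /phis (multilinear_coord _ mw); apply: eq_bigr => f _.
rewrite mulrA; congr (_ * _).
under eq_bigr do rewrite mul_mx_diag !mxE mulrA [_ * 2]mulrC -mulrA.
by rewrite big_split prodr_const card_ord /= big_split mulrA.
Qed.

Lemma forms_phis D D' k (w : kform R n k) :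
  (forall m m', D m -> mdeg m' = k -> D' (mnm_add m' (mdouble m))) ->
  forms D w -> forms D' (phis w).
Proof.
move=> DD' [aw pw]; split=> [u|v]; first exact: alternate_mulmxr.
apply: (eq_polyfun (f := fun u => \sum_(f : {ffun 'I_k -> 'I_N})
    (2 ^+ k * \prod_j v j (f j)) * (\prod_j u 0 (f j) * w (Phi u) (basis_rows R f)))
    (D := D')) => // [u|].
  by rewrite phis_coord//; apply: (aw _).1.
apply: polyfun_sum => f _; apply: polyfunZ.
have [m' m'k m'E] := prod_coord_monom f.
apply: (eq_polyfun (f := fun u => monom m' u * w (Phi u) (basis_rows R f)) (D := D')) => //.
  by move=> u; rewrite m'E.
apply: (polyfunM_monom (D := fun m => exists2 m0, D m0 & m = mdouble m0)).
  by move=> m [m0 Dm0 ->]; apply: DD'.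
by apply: polyfun_Phi (pw _) => m Dm; exists m.
Qed.

End PolynomialForms.

(** * Lifting even forms through [Phi], and restriction to the sphere *)

Section Lifting.
Variables (R : realType) (n : nat).
Local Notation N := n.+1.
Local Notation V := 'rV[R]_N.

Lemma mdeg_mhalf k (f : 'I_k -> 'I_N) (m : multinom N) : injective f ->
  (forall i, odd (m i) = (i \in f @: predT)) -> mdeg m = (2 * mdeg (mhalf m) + k)%N.
Proof.
move=> fi om; rewrite !mdegE big_distrr /=.
have -> : k = (\sum_i (i \in f @: predT))%N.
  by rewrite -[RHS]big_mkcond sum1_card card_imset// card_ord.
rewrite -big_split; apply: eq_bigr => i _ /=.
by rewrite !mnmE -om mul2n addnC odd_double_half.
Qed.

(* An even form is a pullback: each component is a product of distinct
   coordinates times a function of the squares. *)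
Lemma forms_lift r k (w : kform R n k) :
  forms (deg_le (2 * r + k%:Z)) w -> parity 1 w ->
  exists2 eta, forms (deg_le r) eta & w = phis eta.
Proof.
move=> [aw pw] ew.
have /choice [g hg] : forall f : {ffun 'I_k -> 'I_N}, exists g : V -> R,
    polyfun (deg_le r) g /\
    forall u, w u (basis_rows R f) = \prod_j u 0 (f j) * g (Phi u).
  move=> f; have [/injectiveP fi|nfi] := boolP (injectiveb f); last first.
    exists (fun=> 0); split=> [|u]; first exact: polyfun0.
    by rewrite mulr0; apply: alternate_basis_noninj.
  have [||g pg gE] := @parity_factor _ _ (deg_le (2 * r + k%:Z)) (deg_le r)
      (w^~ (basis_rows R f)) (f @: predT) (pw _).
  - move=> i u; rewrite -[LHS]mul1r -[X in X * _](sqrr_sign _ (i \in f @: predT)).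
    rewrite expr2 -mulrA; congr (_ * _).
    rewrite -[RHS]mul1r -(ew i u) /refl.
    rewrite basis_rows_mul_diag (multilinear_diag _ _ (aw _).1); congr (_ * _).
    apply/esym.
    have [/imsetP[j _ ij]|ni] := boolP (i \in _).
      rewrite (bigD1 j)//= big1 ?mulr1 => [|l lj]; first by rewrite !mxE ij eqxx.
      by rewrite !mxE ij (inj_eq fi) (negPf lj).
    rewrite big1// => j _; rewrite !mxE; case: eqVneq => // fji.
    by case/negP: ni; apply/imsetP; exists j.
  - move=> m Dm om; rewrite /deg_le; move: Dm.
    by rewrite /deg_le (mdeg_mhalf fi om); lia.
  exists g; split=> // u; rewrite gE; congr (_ * _).
  by rewrite big_imset //= => a b _ _; apply: fi.
(* The factor [2 ^- k] cancels the 2's in the Jacobian $\mathrm{diag}(2u)$. *)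
pose eta (x : V) (v : 'M[R]_(k, N)) := \sum_(f : {ffun 'I_k -> 'I_N})
  (\prod_j v j (f j)) * (2 ^- k * g f x).
have phisE : w = phis eta.
  apply/funext => u; apply/funext => v.
  rewrite (multilinear_coord v (aw u).1) /phis /eta; apply: eq_bigr => f _.
  under [in RHS]eq_bigr do rewrite mul_mx_diag !mxE mulrCA.
  rewrite (hg f).2 !big_split prodr_const card_ord /=.
  have : (2 : R) ^+ k != 0 by rewrite expf_neq0// pnatr_eq0.
  by move=> h2; field.
exists eta => //; apply: forms_of_coefs => [f|v j1 j2 j12 h].
  by apply: polyfunZ; have [] := hg f.
have pe : polyfun (deg_le r) (eta^~ v).
  by apply: polyfun_sum => f _; apply: polyfunZ; apply: polyfunZ; have [] := hg f.
(* Alternation of [eta] is checked at [Phi u] with [uN u != 0]. There $\mathrm{diag}(2u)$ is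
   invertible, so the value of [eta] is one of [w] on rows with the same repetition. *)
apply: (polyfun_Phi_eq0 pe); apply: (@polyfun_mul_eq0 _ _ (fun=> True) (fun=> True) _ (@uN R n)).
- exact: polyfun_Phi pe.
- exact: polyfun_uN.
- move=> u; have [->|u0] := eqVneq (uN u) 0; first by rewrite mulr0.
  have ui i : u 0 i != 0 by move/prodf_neq0: u0; apply.
  pose v' := v *m diag_mx (\row_i (2 * u 0 i)^-1).
  have vE : v = v' *m diag_mx (2 *: u).
    rewrite /v' -mulmxA mulmx_diag; apply/matrixP => a b.
    rewrite mul_mx_diag !mxE mulVf ?mulr1// mulf_neq0 ?pnatr_eq0//.
  have := congr1 (fun w : kform R n k => w u v') phisE; rewrite /phis -vE => <-.
  rewrite ((aw u).2 v' j1 j2) ?mul0r//.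
  by rewrite /v' !row_mul h.
- by exists (const_mx 1); apply: uN_const1.
Qed.

Lemma restrict_formE M k (w : kform R n k) u v : tangent_to M u v ->
  restrict_form M w u v = w u v.
Proof. by move=> t; rewrite /restrict_form; case: asboolP. Qed.

Lemma restrict_form0 M k (w : kform R n k) u v : ~ tangent_to M u v ->
  restrict_form M w u v = 0.
Proof. by move=> t; rewrite /restrict_form; case: asboolP. Qed.

Lemma eq_restrict_form M k (w w' : kform R n k) :
  (restrict_form M w = restrict_form M w') <->
  (forall u v, tangent_to M u v -> w u v = w' u v).
Proof.
split=> [h u v t|h]; first by rewrite -(restrict_formE w t) h restrict_formE.
apply/funext => u; apply/funext => v; rewrite /restrict_form.
by case: asboolP => // /h.
Qed.

Lemma tangent_reflection i k u (v : 'M[R]_(k, N)) :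
  tangent_to sphere u v ->
  tangent_to sphere (reflection i u) (v *m diag_mx (reflection_diag R i)).
Proof.
move=> [/= su tu]; split=> /= [|j].
  rewrite -su; apply: eq_bigr => l _; rewrite mxE; case: eqP => _ //.
  by rewrite sqrrN.
have := tu j => /= h; rewrite -[RHS]h; apply: eq_bigr => l _.
rewrite mxE [row _ _ _ _]mxE mul_mx_diag !mxE.
by case: eqP => _ /=; rewrite ?expr1 ?expr0 ?mulr1// mulrN1 mulrNN.
Qed.

Lemma tangent_Phi k u (v : 'M[R]_(k, N)) : tangent_to sphere u v ->
  tangent_to simplex (Phi u) (v *m diag_mx (2 *: u)).
Proof.
move=> [/= su tu]; split=> /= [|j].
  split=> [i|]; first by rewrite mxE sqr_ge0.
  by rewrite -[RHS]su; apply: eq_bigr => i _; rewrite mxE.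
transitivity (2 * (\sum_i u 0 i * row j v 0 i)); last by rewrite tu mulr0.
rewrite mulr_sumr; apply: eq_bigr => i _.
by rewrite mxE mul_mx_diag !mxE; ring.
Qed.

Lemma pullback_sphere_Phi k (w : kform R n k) :
  pullback sphere Phi (restrict_form simplex w) = restrict_form sphere (phis w).
Proof.
apply/eq_restrict_form => u v t; rewrite jacobian_Phi restrict_formE//.
exact: tangent_Phi.
Qed.

Lemma pullback_reflectionE i k (w : kform R n k) :
  pullback sphere (reflection i) (restrict_form sphere w) =
  restrict_form sphere (refl i w).
Proof.
apply/eq_restrict_form => u v t; rewrite jacobian_reflection restrict_formE//.
exact: tangent_reflection.
Qed.

Definition sphere_parity (eps : R) k (w : kform R n k) : Prop :=
  forall i u v, tangent_to sphere u v -> refl i w u v = eps * w u v.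

Lemma even_formsE k (w : kform R n k) :
  even_forms (restrict_form sphere w) <-> sphere_parity 1 w.
Proof.
split=> [h i|h i].
  by have := h i; rewrite pullback_reflectionE => /eq_restrict_form e u v t; rewrite e// mul1r.
by rewrite pullback_reflectionE; apply/eq_restrict_form => u v /h->; rewrite mul1r.
Qed.

Lemma odd_formsE k (w : kform R n k) :
  odd_forms (restrict_form sphere w) <-> sphere_parity (-1) w.
Proof.
have E : - restrict_form sphere w = restrict_form sphere (fun u v => - w u v).
  apply/funext => u; apply/funext => v; rewrite /restrict_form.
  change ((- (fun u v => if `[< tangent_to sphere u v >] then w u v else 0)) u v) with
    (- (if `[< tangent_to sphere u v >] then w u v else 0)).
  by case: ifP; rewrite ?oppr0.
split=> [h i|h i].
  have := h i; rewrite pullback_reflectionE E => /eq_restrict_form e u v t.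
  by rewrite e// mulN1r.
by rewrite pullback_reflectionE E; apply/eq_restrict_form => u v /h->; rewrite mulN1r.
Qed.

(* Averaging over the group generated by the reflections does not change w
   where w has the right parity already. *)
Lemma forms_average D eps k (w : kform R n k) (T : V -> 'M[R]_(k, N) -> Prop) :
  eps ^+ 2 = 1 -> forms D w ->
  (forall i u v, T u v ->
     T (reflection i u) (v *m diag_mx (reflection_diag R i))) ->
  (forall i u v, T u v -> refl i w u v = eps * w u v) ->
  exists2 w', forms D w' /\ parity eps w' & forall u v, T u v -> w' u v = w u v.
Proof.
move=> e1 Dw TR sw.
suff [w' [Dw' w'w pw']] : exists w', [/\ forms D w',
    forall u v, T u v -> w' u v = w u v &
    forall i, i \in enum 'I_N -> forall u v, refl i w' u v = eps * w' u v].
  by exists w' => //; split=> // i; apply: pw'; rewrite mem_enum.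
elim: (enum 'I_N) => [|i s [w' [Dw' w'w pw']]]; first by exists w.
(* The projection $\frac12(w'+\varepsilon R_i^*w')$; since reflections commute, it keeps the parity
   already reached for the indices in [s]. *)
exists (fun u v => 2^-1 * w' u v + (2^-1 * eps) * refl i w' u v).
split=> [|u v t|j].
- by apply: formsDZ => //; apply: forms_refl.
- have -> : refl i w' u v = eps * w' u v.
    by rewrite /refl !w'w//; [exact: sw|exact: TR].
  by rewrite -(w'w u v t) mulrA -[_ * eps * eps]mulrA -expr2 e1; field.
- rewrite inE => /orP[/eqP->|js] u v.
    rewrite -[LHS]/(2^-1 * refl i w' u v + (2^-1 * eps) * refl i (refl i w') u v).
    rewrite reflK mulrDr !mulrA ![eps * _]mulrC -mulrA [X in X * refl _ _ _ _](_ : _ = 2^-1).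
      by rewrite addrC [2^-1 * (eps * _)]mulrA.
    by rewrite -mulrA -expr2 e1 mulr1.
  rewrite -[LHS]/(2^-1 * refl j w' u v + (2^-1 * eps) * refl j (refl i w') u v).
  have -> : refl j (refl i w') u v = eps * refl i w' u v.
    by rewrite reflC /refl -!/(refl j w' _ _) pw'.
  by rewrite pw'//; ring.
Qed.

End Lifting.

(** Expansion along the first column. In the minor of [c j 0] the row [r] stands on top; moving it
    to place [j] costs $(-1)^j$, which leaves $-1$ of the cofactor sign $(-1)^{j+1}$. *)
Lemma det_border (R : numFieldType) p (s : R) (r : 'rV[R]_p) (c : 'cV[R]_p) (A : 'M[R]_p) :
  \det (block_mx s%:M r c A) = s * \det A - \sum_j c j 0 * \det (setrow j r A).
Proof.
rewrite (expand_det_col _ (lshift p 0)) big_split_ord /= big_ord1; congr (_ + _).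
  rewrite block_mxEul mxE eqxx mulr1n /cofactor addn0 expr0 mul1r; congr (_ * \det _).
  have l0 (k : 'I_p) : lift (lshift p (0 : 'I_1)) k = rshift 1 k by apply: val_inj.
  by apply/matrixP => i j; rewrite [LHS]mxE [LHS]mxE !l0 block_mxEdr.
rewrite -sumrN; case: p r c A => [|q] r c A; first by rewrite !big_ord0.
apply: eq_bigr => j _; rewrite block_mxEdl -mulrN; congr (_ * _).
(* Both determinants are expanded along the row that carries [r], where their minors coincide. *)
rewrite /cofactor (expand_det_row _ 0) (expand_det_row _ j) mulr_sumr -sumrN.
apply: eq_bigr => l _; rewrite /cofactor.
set M' := row' (rshift 1 j) _; set M := block_mx _ _ _ _ in M' *.
have l0 (k : 'I_q.+1) : lift (lshift q.+1 (0 : 'I_1)) k = rshift 1 k by apply: val_inj.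
have j0 : lift (rshift 1 j) 0 = lshift q.+1 (0 : 'I_1) by apply: val_inj.
have jl k : lift (rshift 1 j) (lift 0 k) = rshift 1 (lift j k).
  by apply: val_inj; rewrite /= /bump /= leq_add2l addnCA.
have -> : M' 0 l = r 0 l by rewrite [LHS]mxE [LHS]mxE j0 l0 block_mxEur.
have -> : row' 0 (col' l M') = row' j (col' l (setrow j r A)).
  apply/matrixP => a b; do 3 rewrite [RHS]mxE; do 4 rewrite [LHS]mxE.
  by rewrite jl l0 block_mxEdr eq_sym (negPf (neq_lift j a)).
rewrite [setrow _ _ _ _ _]mxE eqxx; set d := \det _.
have -> : (rshift 1 j + lshift q.+1 (0 : 'I_1)%R)%N = j.+1 by rewrite /= addn0.
rewrite -[((0 : 'I_q.+1)%R + l)%N]/(nat_of_ord l) exprS exprD; ring.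
Qed.

(** * Exactness of the Koszul complex *)

Section Koszul.
Variables (R : realType) (n : nat).
Local Notation N := n.+1.
Local Notation V := 'rV[R]_N.

Definition ord_cons p (i : 'I_N) (f : 'I_p -> 'I_N) (j : 'I_p.+1) : 'I_N :=
  if unlift ord0 j is Some j' then f j' else i.

Lemma alternate_colsub p q (g : 'I_p -> 'I_q) :
  alternate (fun v : 'M[R]_(p, q) => \det (colsub g v)).
Proof.
have E (v : 'M[R]_(p, q)) : colsub g v = v *m colsub g 1%:M.
  by rewrite mulmx_colsub mulmx1.
rewrite (_ : (fun _ => _) = (fun v => \det (v *m colsub g 1%:M))).
  by apply: (alternate_mulmxr (w := fun v => \det v)); apply: alternate_det.
by apply/funext => v; rewrite E.
Qed.

(** The interior product of $dx_i\wedge dx_f$ with $u$, evaluated on the rows of [v]. *)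
Lemma det_cons p i (f : 'I_p -> 'I_N) (u : V) (v : 'M[R]_(p, N)) :
  \det (colsub (ord_cons i f) (col_mx u v)) =
  u 0 i * \det (colsub f v) - \sum_j v j i * \det (colsub f (setrow j u v)).
Proof.
have -> : colsub (ord_cons i f) (col_mx u v) =
    block_mx (u 0 i)%:M (colsub f u) (col i v) (colsub f v) :> 'M[R]_(1 + p).
  apply/matrixP => a b; rewrite mxE.
  have cl (b0 : 'I_1) : ord_cons i f (lshift p b0) = i.
    by rewrite /ord_cons (_ : lshift p b0 = ord0) ?unlift_none//; apply: val_inj; rewrite /= ord1.
  have cr (b0 : 'I_p) : ord_cons i f (rshift 1 b0) = f b0.
    rewrite /ord_cons (_ : rshift 1 b0 = lift ord0 b0) ?liftK//; exact: val_inj.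
  case: (split_ordP b) => b0 ->; rewrite ?cl ?cr; case: (split_ordP a) => a0 ->.
  - by rewrite col_mxEu block_mxEul !ord1 mxE eqxx.
  - by rewrite col_mxEd block_mxEdl mxE.
  - by rewrite col_mxEu block_mxEur mxE ord1.
  - by rewrite col_mxEd block_mxEdr mxE.
rewrite det_border; congr (_ - _); apply: eq_bigr => j _.
rewrite mxE; congr (_ * \det _).
by apply/matrixP => a b; rewrite !mxE; case: eqP => _; rewrite ?mxE.
Qed.

(** By Cartan's formula $i_U d\delta=L_U\delta-d\,i_U\delta=(m+p)\delta$ when $i_U\delta=0$. Thus
    [zeta] is $d\delta/(m+p)$ in coordinates, and the $p!$ in [C] comes from summing over all
    [f]. *)
Lemma koszul_exact (m : int) p (delta : kform R n p) :
  forms (deg_eq m) delta ->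
  (forall u v j, row j v = u -> delta u v = 0) ->
  m + p%:Z != 0 ->
  exists2 zeta : kform R n p.+1, forms (deg_eq (m - 1)) zeta &
    interior_radial zeta = delta.
Proof.
move=> [ad pd] di mp.
have /choice [a ha] : forall f : {ffun 'I_p -> 'I_N}, exists a : mpoly N R,
    (forall l, mcoeff l a != 0 -> deg_eq m l) /\
    forall u, delta u (basis_rows R f) = ev a u.
  by move=> f; apply: pd.
pose C : R := (p`!%:R * (m + p%:Z)%:~R)^-1.
pose zeta (u : V) (W : 'M[R]_(p.+1, N)) : R :=
  \sum_i \sum_(f : {ffun 'I_p -> 'I_N})
     \det (colsub (ord_cons i f) W) * (C * ev (mderiv i (a f)) u).
exists zeta.
  split=> [u|W].
    rewrite /zeta (_ : (fun W => _) = (fun W : 'M[R]_(p.+1, N) =>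
        \sum_i (\sum_(f : {ffun 'I_p -> 'I_N})
     \det (colsub (ord_cons i f) W) * (C * ev (mderiv i (a f)) u)) * 1)).
      by do 2 (apply: alternate_lin => ? _); apply: alternate_colsub.
    by apply/funext => W; apply: eq_bigr => i _; rewrite mulr1.
  apply: polyfun_sum => i _; apply: polyfun_sum => f _; do 2 apply: polyfunZ.
  by apply: polyfun_ev; apply: mderiv_deg_eq; have [] := ha f.
have dE u v : p`!%:R * delta u v = \sum_(f : {ffun 'I_p -> 'I_N})
    ev (a f) u * \det (colsub f v).
  by rewrite alternate_coord//; apply: eq_bigr => f _; rewrite (ha f).2.
apply/funext => u; apply/funext => v; rewrite /interior_radial /zeta.
(* The $i$-th partial derivative of the identity $\delta_u(\dots,u,\dots)=0$: it hits either the
   coefficients [a f] or the vector $u$ in row [j]. *)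
have deriv_zero i j : \sum_(f : {ffun 'I_p -> 'I_N})
    ev (mderiv i (a f)) u * \det (colsub f (setrow j u v)) =
    - (p`!%:R * delta u (setrow j (delta_mx 0 i) v)).
  pose c (f : {ffun 'I_p -> 'I_N}) l := \det (colsub f (setrow j (delta_mx 0 l) v)).
  have cE (f : {ffun 'I_p -> 'I_N}) (x : V) :
      \det (colsub f (setrow j x v)) = \sum_l x 0 l * c f l.
    rewrite {1}(row_sum_delta x).
    by rewrite (multilinear_sum j v _ _ _ (alternate_colsub f).1).
  have P0 : \sum_(f : {ffun 'I_p -> 'I_N}) \sum_l c f l *: (a f * mpolyX R (mnm1 l)) = 0.
    apply: ev_inj => x; rewrite /ev meval0 -/(ev _ x) ev_sum.
    transitivity (p`!%:R * delta x (setrow j x v)); last first.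
      by rewrite (di _ _ j) ?mulr0// row_setrow.
    rewrite dE; apply: eq_bigr => f _; rewrite cE ev_sum mulr_sumr.
    apply: eq_bigr => l _; rewrite /ev mevalZ -/(ev _ x) evM evX monom1; ring.
  have := congr1 (fun P => ev (mderiv i P) u) P0.
  rewrite mderiv0 /ev meval0 -/(ev _ u) raddf_sum ev_sum => H.
  apply/eqP; rewrite -addr_eq0 dE -big_split /= -[X in _ == X]H.
  apply/eqP; apply: eq_bigr => f _.
  transitivity (\sum_l ev (mderiv i (c f l *: (a f * mpolyX R (mnm1 l)))) u); last first.
    by rewrite -ev_sum; congr (ev _ u); apply/esym/raddf_sum.
  rewrite [in LHS]cE mulr_sumr -/(c f i).
  have -> : ev (a f) u * c f i = \sum_l (l == i)%:R * (ev (a f) u * c f l).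
    rewrite (bigD1 i)//= eqxx mul1r big1 ?addr0// => l /negPf->.
    by rewrite mul0r.
  rewrite -big_split; apply: eq_bigr => l _ /=.
  rewrite mderivZ mderivM mderivX /ev mevalZ mevalD !mevalM mevalZ -!/(ev _ u).
  rewrite evX monom1 mnmE; have [->|li] := eqVneq l i.
    rewrite (_ : mnm_sub _ _ = mnm0) ?evX; last first.
      by apply/mnmP => k; rewrite !mnmE subnn.
    by rewrite (_ : monom mnm0 u = 1); [ring|rewrite /monom big1// => k _; rewrite mnmE].
  by rewrite -[false%:R]/(0 : R); ring.
have p0 : (p`!%:R : R) != 0 by rewrite pnatr_eq0 -lt0n fact_gt0.
have mp0 : ((m + p%:Z)%:~R : R) != 0 by rewrite intr_eq0.
(* Euler's identity contributes $m$; the derivatives of $i_U\delta=0$ contribute 1 for each of the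
   $p$ rows. *)
have key : \sum_i \sum_(f : {ffun 'I_p -> 'I_N})
    \det (colsub (ord_cons i f) (col_mx u v)) * ev (mderiv i (a f)) u =
  p`!%:R * (m + p%:Z)%:~R * delta u v.
  transitivity (\sum_i (\sum_(f : {ffun 'I_p -> 'I_N})
      u 0 i * ev (mderiv i (a f)) u * \det (colsub f v)
      + \sum_j v j i * (p`!%:R * delta u (setrow j (delta_mx 0 i) v)))).
    apply: eq_bigr => i _.
    under eq_bigr do rewrite det_cons mulrBl.
    rewrite sumrB; congr (_ + _); first by apply: eq_bigr => f _; ring.
    under eq_bigr do rewrite mulr_suml.
    rewrite exchange_big -sumrN; apply: eq_bigr => j _ /=.
    rewrite -[p`!%:R * _]opprK -deriv_zero mulrN; congr (- _).
    by rewrite mulr_sumr; apply: eq_bigr => f _; ring.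
  rewrite big_split /=.
  have -> : \sum_i \sum_(f : {ffun 'I_p -> 'I_N})
      u 0 i * ev (mderiv i (a f)) u * \det (colsub f v) = m%:~R * (p`!%:R * delta u v).
    rewrite exchange_big dE mulr_sumr; apply: eq_bigr => f _ /=.
    rewrite -mulr_suml mulrA; congr (_ * _).
    have := congr1 (fun P => ev P u) (euler (ha f).1).
    rewrite ev_sum [in RHS]/ev mevalZ -/(ev _ u) => <-.
    by apply: eq_bigr => i _; rewrite evM evX monom1.
  have -> : \sum_i \sum_j v j i * (p`!%:R * delta u (setrow j (delta_mx 0 i) v)) =
      p%:R * (p`!%:R * delta u v).
    transitivity (\sum_(j < p) p`!%:R * delta u v); last first.
      by rewrite sumr_const card_ord [RHS]mulr_natl.
    rewrite exchange_big; apply: eq_bigr => j _ /=; rewrite -[in RHS](setrow_id j v).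
    rewrite (row_sum_delta (row j v)) (multilinear_sum j v _ _ _ (ad u).1) mulr_sumr.
    by apply: eq_bigr => i _; rewrite mxE mulrCA.
  by rewrite -mulrDl intrD; ring.
transitivity (C * \sum_i \sum_(f : {ffun 'I_p -> 'I_N})
    \det (colsub (ord_cons i f) (col_mx u v)) * ev (mderiv i (a f)) u).
  rewrite mulr_sumr; apply: eq_bigr => i _; rewrite mulr_sumr.
  by apply: eq_bigr => f _; rewrite mulrCA.
by rewrite key /C mulKf// mulf_neq0.
Qed.

End Koszul.

Lemma alternate_mulmxl (R : numFieldType) k N (w : 'M[R]_(k, N) -> R) (A : 'M[R]_k) v :
  alternate w -> w (A *m v) = \det A * w v.
Proof.
move=> aw; have av := alternate_mulmxr v aw.
have k0 : (k`!%:R : R) != 0 by rewrite pnatr_eq0 -lt0n fact_gt0.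
apply: (mulfI k0); rewrite (alternate_coord A av) -[v in RHS]mul1mx mulrCA.
rewrite (alternate_coord 1%:M av) mulr_sumr; apply: eq_bigr => f _.
rewrite mulrCA -det_mulmx; congr (_ * \det _).
by rewrite mulmx_colsub mulmx1.
Qed.

(** With $u$ in the first slot, the other vectors matter only modulo $u$, so they may be replaced by
    their tangential parts. *)
Lemma alternate_shear (R : numFieldType) p N (w : 'M[R]_(1 + p, N) -> R)
    (u : 'rV[R]_N) (v : 'M[R]_(p, N)) (c : 'cV[R]_p) :
  alternate w -> w (col_mx u (v + c *m u)) = w (col_mx u v).
Proof.
move=> aw.
have -> : col_mx u (v + c *m u) = block_mx 1%:M 0 c 1%:M *m col_mx u v.
  by rewrite mul_block_col !mul1mx mul0mx addr0 addrC.
by rewrite alternate_mulmxl// det_lblock !det1 !mul1r.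
Qed.

Lemma alternate_interior (R : numFieldType) p N (w : 'M[R]_(1 + p, N) -> R)
    (u : 'rV[R]_N) :
  alternate w -> alternate (fun v : 'M[R]_(p, N) => w (col_mx u v)).
Proof.
move=> aw; apply: (alternate_place (F := col_mx u) (c := @rshift 1 p) aw).
- exact: rshift_inj.
- by move=> v j l; rewrite col_mxEd.
- move=> v v' i l; case: (split_ordP i) => i0 -> h; rewrite ?col_mxEu//.
  by case/negP: h; apply: codom_f.
Qed.

(** * Division by $u_N$ in the image of the radial interior product *)

Section Division.
Variables (R : realType) (n : nat).
Local Notation N := n.+1.
Local Notation V := 'rV[R]_N.

Lemma forms0 D k : forms D ((fun _ _ => 0) : kform R n k).
Proof.
split=> [x|v]; last exact: polyfun0.
by split=> [v v1 v2 j a b _ _ _|//]; rewrite !mulr0 addr0.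
Qed.

Lemma polyfun_homogeneous d (f : V -> R) s x : polyfun (deg_eq d%:Z) f ->
  f (s *: x) = s ^+ d * f x.
Proof.
move=> [p [pd fp]]; rewrite !fp !evE mulr_sumr big_seq [RHS]big_seq.
apply: eq_bigr => m; rewrite mcoeff_msupp => /pd md; rewrite mulrCA; congr (_ * _).
have -> : d = mdeg m by case: md.
rewrite mdegE -prodrXr /monom -big_split; apply: eq_bigr => i _ /=.
by rewrite mxE exprMn.
Qed.

Lemma forms_interior D D' p (theta : kform R n p.+1) :
  (forall m i, D m -> D' (mnm_add (mnm1 i) m)) ->
  forms D theta -> forms D' (interior_radial theta).
Proof.
move=> DD' [at_ pt]; split=> [u|v].
  exact: (alternate_interior u (at_ u)).
apply: (@eq_polyfun R N D' D' (fun x : V => \sum_i x 0 i *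
   theta x (col_mx (delta_mx 0 i : V) v))) => [x|//|].
  have E (r : V) : col_mx r v = setrow (lshift p 0) r (col_mx 0 v) :> 'M[R]_(1 + p, N).
    apply/matrixP => a l; rewrite [RHS]mxE; case: (split_ordP a) => a0 ->.
      by rewrite col_mxEu ord1 eqxx.
    by rewrite !col_mxEd.
  rewrite /interior_radial [in RHS]E [X in setrow _ X _](row_sum_delta x).
  rewrite (@multilinear_sum R (1 + p) N (theta x) _ _ _ _ _ _ (at_ x).1).
  by apply: eq_bigr => i _; rewrite -E.
apply: polyfun_sum => i _.
apply: (@eq_polyfun R N D' D' (fun x : V => monom (mnm1 i) x *
   theta x (col_mx (delta_mx 0 i : V) v))) => [x|//|]; first by rewrite monom1.
by apply: polyfunM_monom (pt _) => m; apply: DD'.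
Qed.

Lemma refl_interior i p (theta : kform R n p.+1) u v :
  interior_radial (refl i theta) u v = refl i (interior_radial theta) u v.
Proof.
rewrite /interior_radial /refl.
have E : (col_mx u v : 'M[R]_(1 + p, N)) *m diag_mx (reflection_diag R i) =
   col_mx (u *m diag_mx (reflection_diag R i)) (v *m diag_mx (reflection_diag R i)).
  exact: mul_col_mx.
by rewrite -reflection_mulmx in E; apply: (congr1 (theta (reflection i u)) E).
Qed.

Lemma sphere_scaling i (u : V) : (1 <= n)%N -> u 0 i = 0 ->
  exists s u', [/\ u = s *: u', carrier sphere u' & u' 0 i = 0].
Proof.
move=> hn ui; pose s := \sum_j u 0 j ^+ 2.
have s0 : 0 <= s by apply: sumr_ge0 => j _; rewrite sqr_ge0.
have [s_eq0|s_neq0] := eqVneq s 0.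
  have uj0 j : u 0 j = 0.
    move/eqP: s_eq0; rewrite psumr_eq0 => [/allP/(_ j)|? _]; last exact: sqr_ge0.
    by rewrite mem_index_enum sqrf_eq0 => /(_ isT)/eqP.
  (* The origin is 0 times a unit vector of the hyperplane $u_i=0$, which exists because $n\ge1$. *)
  have [j ji] : exists j : 'I_N, j != i.
    exists (lift i (Ordinal hn)); by rewrite eq_sym neq_lift.
  exists 0, (delta_mx 0 j); split.
  - by apply/rowP => l; rewrite scale0r mxE uj0.
  - rewrite /= (bigD1 j)//= big1 => [|l lj]; rewrite !mxE.
      by rewrite !eqxx expr1n addr0.
    by rewrite (negPf lj) expr0n.
  - by rewrite mxE eq_sym (negPf ji).
exists (Num.sqrt s), ((Num.sqrt s)^-1 *: u).
have q0 : Num.sqrt s != 0 by rewrite sqrtr_eq0 -ltNge lt0r s_neq0.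
split.
- by rewrite scalerA divff// scale1r.
- rewrite /=; under eq_bigr do rewrite mxE exprMn.
  by rewrite -mulr_sumr exprVn sqr_sqrtr// mulVf.
- by rewrite mxE ui mulr0.
Qed.

Lemma uN_reflection i (u : V) : uN (reflection i u) = - uN u.
Proof.
rewrite /uN (bigD1 i)//= [in RHS](bigD1 i)//= mxE eqxx mulNr; congr (- (_ * _)).
by apply: eq_bigr => j ji; rewrite mxE (negPf ji).
Qed.

(* Division by u_N in the image of i_U: the quotient is again killed by i_U,
   hence lies in that image by exactness of the Koszul complex. *)
Lemma interior_divide_uN (d : int) p (theta : kform R n p.+1) : (1 <= n)%N ->
  forms (deg_eq d) theta ->
  (forall i u v, tangent_to sphere u v -> u 0 i = 0 -> interior_radial theta u v = 0) ->
  (d + 1 = N%:Z -> p = 0%N -> parity 1 theta) ->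
  exists2 zeta : kform R n p.+1, forms (deg_eq (d - N%:Z)) zeta &
    forall u v, interior_radial theta u v = uN u * interior_radial zeta u v.
Proof.
move=> hn ft th0 pth.
have [d0|d0] := ltP d 0.
  exists (fun _ _ => 0); first exact: forms0.
  move=> u v; rewrite /interior_radial mulr0.
  have -> // := forms_neg _ ft; by move=> m; rewrite /deg_eq => md; move: d0; rewrite -md.
have fi : forms (deg_eq (d + 1)) (interior_radial theta).
  by apply: forms_interior ft => m i; rewrite /deg_eq mdegD mdeg1 => <-; lia.
have i0 i (u : V) v : u 0 i = 0 -> interior_radial theta u v = 0.
  move=> /(sphere_scaling hn)[s [u' [-> su' u'i]]].
  have d1 : d + 1 = (`|d|.+1)%N%:Z by lia.
  have := fi.2 v; rewrite d1 => /polyfun_homogeneous ->.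
  (* The radial part of each row is split off; the shear removes it and leaves vectors tangent to
     the sphere at [u']. *)
  rewrite -[v](addrNK ((v *m u'^T) *m u')).
  rewrite /interior_radial (alternate_shear _ _ _ (ft.1 u')).
  rewrite -/(interior_radial theta u' _) (th0 i) ?mulr0//; split=> // j /=.
  have uu : u' *m u'^T = 1%:M.
    apply/matrixP => a b; rewrite !ord1 mxE mxE eqxx -[RHS]su'.
    by apply: eq_bigr => l _; rewrite mxE expr2.
  have : (v - v *m u'^T *m u') *m u'^T = 0.
    by rewrite mulmxBl -[_ *m u' *m _]mulmxA uu mulmx1 subrr.
  move=> /matrixP/(_ j 0); rewrite mxE [RHS]mxE => h; rewrite -[RHS]h.
  by apply: eq_bigr => l _; rewrite mulrC [row _ _ _ _]mxE [u'^T _ _]mxE.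
have [delta fd deltaE] : exists2 delta : kform R n p,
    forms (deg_eq (d + 1 - N%:Z)) delta &
    forall u v, interior_radial theta u v = uN u * delta u v.
  apply: (forms_divide_uN fi i0) => m.
  rewrite /deg_eq => md m0; rewrite -md.
  have : mdeg m = (mdeg (mpred m) + N)%N.
    transitivity (\sum_(i < N) (mpred m i + 1))%N.
      by rewrite mdegE; apply: eq_bigr => i _; rewrite mnmE addn1 prednK.
    by rewrite big_split sum1_card card_ord mdegE.
  by move=> ->; lia.
have [m0|m0] := ltP (d + 1 - N%:Z) 0.
  exists (fun _ _ => 0); first exact: forms0.
  move=> u v; rewrite deltaE /interior_radial mulr0.
  have -> := forms_neg _ fd; first by rewrite mulr0.
  by move=> m; rewrite /deg_eq => md; move: m0; rewrite -md.
have dzero u v j : row j v = u -> delta u v = 0.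
  (* The inserted vector moves with the base point, so polynomiality needs an expansion of that row
     before cancelling $u_N$. *)
  have pf : polyfun (fun=> True) (fun x : V => delta x (setrow j x v)).
    apply: (@eq_polyfun R N (fun=> True) _ (fun x : V =>
        \sum_l monom (mnm1 l) x * delta x (setrow j (delta_mx 0 l) v))) => [x|//|].
      rewrite [X in setrow _ X _](row_sum_delta x).
      rewrite (multilinear_sum _ _ _ _ _ (fd.1 x).1).
      by apply: eq_bigr => l _; rewrite monom1.
    by apply: polyfun_sum => l _; apply: polyfunM_monom (fd.2 _).
  move=> vu; rewrite -(setrow_id j v) vu.
  apply: (polyfun_mul_eq0 pf (polyfun_uN R n)); last first.
    by exists (const_mx 1); apply: uN_const1.
  move=> x; rewrite mulrC -deltaE.
  have a2 : forall (v : 'M[R]_(1 + p, N)) j1 j2, j1 != j2 -> row j1 v = row j2 v ->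
    theta x v = 0 := (ft.1 x).2.
  apply: (a2 _ (lshift p 0) (rshift 1 j)) => //.
  by apply/row_eqP => l; rewrite col_mxEu col_mxEd mxE eqxx.
(* In the exceptional case both the degree and [p] are 0, so [delta] is constant. Then $u_N\delta$
   is odd, while [theta] is even, and both vanish on comparing them. *)
have [mp|mp] := eqVneq (d + 1 - N%:Z + p%:Z) 0; last first.
  have [zeta fz zE] := koszul_exact fd dzero mp.
  exists zeta; last by move=> u v; rewrite deltaE zE.
  by apply: forms_sub fz => m; rewrite /deg_eq; lia.
have [p0 dN] : p = 0%N /\ d + 1 = N%:Z by split; lia.
have delta0 u v : delta u v = 0.
  apply: (polyfun_mul_eq0 (fd.2 v) (polyfun_uN R n)); last first.
    by exists (const_mx 1); apply: uN_const1.
  move=> {}u; rewrite mulrC.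
  have v0 (v' : 'M[R]_(p, N)) : v' = v.
    by apply/matrixP => a; have := ltn_ord a; rewrite [X in (_ < X)%N]p0.
  have fd0 : polyfun (deg_eq 0%N%:Z) (delta^~ v).
    by apply: eq_polyfun (fd.2 v) => // m; rewrite /deg_eq; lia.
  have dc x : delta x v = delta 0 v.
    by rewrite -(scale0r x) (polyfun_homogeneous _ _ fd0) expr0 mul1r.
  suff E : uN (reflection 0 u) * delta (reflection 0 u) v = uN u * delta u v.
    by move: E; rewrite uN_reflection (dc (reflection 0 u)) -(dc u); lra.
  rewrite -[v in LHS](v0 (v *m diag_mx (reflection_diag R 0))) -!deltaE.
  by rewrite -[LHS]refl_interior /interior_radial (pth dN p0) mul1r.
exists (fun _ _ => 0); first exact: forms0.
by move=> u v; rewrite deltaE delta0 /interior_radial !mulr0.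
Qed.
End Division.

(** * Lifting tangent vectors of the simplex, and density of open faces *)

Section Simplex.
Variables (R : realType) (n : nat).
Local Notation N := n.+1.
Local Notation V := 'rV[R]_N.

(** The differential $\mathrm{diag}(2u)$ reaches every vector that vanishes where $u$ does. The lift
    divides by $2\sqrt{x_i}$, and the convention $x/0=0$ settles the zero coordinates. *)
Lemma tangent_lift k (x : V) (v : 'M[R]_(k, N)) : tangent_to simplex x v ->
  (forall a i, x 0 i = 0 -> v a i = 0) ->
  exists u v', [/\ tangent_to sphere u v', Phi u = x & v = v' *m diag_mx (2 *: u)].
Proof.
move=> [/= [x0 x1] tv] vx.
pose u : V := \row_i Num.sqrt (x 0 i).
have ux i : u 0 i ^+ 2 = x 0 i by rewrite mxE sqr_sqrtr.
have uv a i : v a i = v a i / (2 * u 0 i) * (2 * u 0 i).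
  have [xi|xi] := eqVneq (x 0 i) 0; first by rewrite (vx a)// !mul0r.
  have ui : u 0 i != 0 by rewrite -sqrf_eq0 ux.
  by rewrite mulfVK// mulf_neq0 ?pnatr_eq0.
pose v' : 'M[R]_(k, N) := \matrix_(a, i) (v a i / (2 * u 0 i)).
exists u, v'; split.
- split=> /= [|j]; first by under eq_bigr do rewrite ux.
  have := tv j => h; apply: (@mulfI R 2); first by rewrite pnatr_eq0.
  rewrite mulr0 -[RHS]h mulr_sumr; apply: eq_bigr => i _.
  have -> : row j v 0 i = v j i by rewrite mxE.
  have -> : row j v' 0 i = v j i / (2 * u 0 i) by rewrite [LHS]mxE [LHS]mxE.
  rewrite [RHS]uv; ring.
- by apply/rowP => i; rewrite mxE ux.
- apply/matrixP => a i; rewrite mul_mx_diag [RHS]mxE [v' _ _]mxE [LHS]uv.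
  by rewrite [(2 *: u) _ _]mxE.
Qed.

Lemma poly_zero_near0 (q : {poly R}) : (forall t, 0 < t -> t <= 1 -> q.[t] = 0) -> q = 0.
Proof.
move=> q0; apply: contrapT => /eqP qn0.
(* The points $1,1/2,1/3,\dots$ of $(0,1]$: [size q] distinct roots, one more than the degree
   allows. *)
pose s := [seq (i.+1%:R : R)^-1 | i <- iota 0 (size q)].
have := @max_poly_roots _ q s qn0; rewrite size_map size_iota ltnn => h.
suff : false by []; apply: h.
  apply/allP => _ /mapP[i _ ->]; apply/eqP; apply: q0; first by rewrite invr_gt0.
  by rewrite invf_le1// ler1n.
rewrite map_inj_uniq ?iota_uniq// => i j /invr_inj /eqP.
by rewrite eqr_nat eqSS => /eqP.
Qed.

(* The relative interior of a face is dense in the face. *)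
Lemma polyfun_face_eq0 D (f : V -> R) (Z : pred 'I_N) i0 : polyfun D f -> ~~ Z i0 ->
  (forall x, carrier simplex x -> (forall i, Z i = (x 0 i == 0)) -> f x = 0) ->
  forall x, carrier simplex x -> (forall i, Z i -> x 0 i = 0) -> f x = 0.
Proof.
move=> pf Zi0 f0 x [x0 x1] xZ.
(* [c] counts the vertices of the face and [b] is its barycentre; the segment from [x] to [b] runs
   in the open face except possibly at [x]. *)
pose c : R := \sum_i (~~ Z i)%:R.
have c0 : 0 < c.
  rewrite /c (bigD1 i0)//= Zi0 ltr_pwDl// sumr_ge0// => i _; exact: ler0n.
pose b : V := \row_i ((~~ Z i)%:R / c).
have b1 : \sum_i b 0 i = 1.
  by under eq_bigr do rewrite mxE; rewrite -mulr_suml divff// gt_eqF.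
have [q qE] := polyfun_line x (b - x) pf.
suff q0 : q = 0 by rewrite -[x]addr0 -(scale0r (b - x)) qE q0 horner0.
apply: poly_zero_near0 => t t0 t1; rewrite -qE; apply: f0.
  split=> [i|].
    rewrite !mxE; have -> : x 0 i + t * ((~~ Z i)%:R / c - x 0 i) =
      (1 - t) * x 0 i + t * ((~~ Z i)%:R / c) by ring.
    by rewrite addr_ge0// mulr_ge0// ?subr_ge0// ?divr_ge0// ltW.
  rewrite -[RHS]x1; under eq_bigr do rewrite mxE mxE mxE [(- x) _ _]mxE.
  by rewrite big_split /= -mulr_sumr sumrB b1 x1 subrr mulr0 addr0.
move=> i; rewrite !mxE; case: (boolP (Z i)) => Zi /=.
  by rewrite xZ// mul0r subrr mulr0 addr0 eqxx.
apply/esym/negbTE; rewrite gt_eqF//.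
have -> : x 0 i + t * (1 / c - x 0 i) = (1 - t) * x 0 i + t / c by ring.
by rewrite ltr_wpDl// ?divr_gt0// mulr_ge0// subr_ge0.
Qed.

(** At points with no zero coordinate every tangent vector lifts to the sphere; the boundary follows
    by density. *)
Lemma phis_inj D k (w : kform R n k) : forms D w ->
  (forall u v, tangent_to sphere u v -> phis w u v = 0) ->
  forall x v, tangent_to simplex x v -> w x v = 0.
Proof.
move=> [aw pw] w0 x v [cx tv].
apply: (@polyfun_face_eq0 D (w^~ v) pred0 0 (pw v)) => // y cy y0.
have [||u [v' [tu <- ->]]] := @tangent_lift k y v; first by split.
  by move=> a i /eqP; rewrite -y0.
exact: w0.
Qed.

(** Where $u_i=0$ the differential of [Phi] has zero $i$-th component, so it sends every tangent
    vector of the sphere, even one transverse to $u_i=0$, to a vector tangent to the facet. *)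
Lemma vanishing_on_boundaryP D k (w : kform R n k) : (1 <= n)%N -> forms D w ->
  vanishing_on_boundary (restrict_form simplex w) <->
  (forall i u v, tangent_to sphere u v -> u 0 i = 0 -> phis w u v = 0).
Proof.
move=> hn [aw pw]; split=> [w0 i u v t ui|w0 i].
  have [cx tv] := tangent_Phi t; have := congr1 (fun w => w (Phi u) (v *m diag_mx (2 *: u))) (w0 i).
  rewrite restrict_formE.
    by rewrite restrict_formE//; split.
  split=> [|j] /=; first by split=> //; rewrite mxE ui expr0n.
  by split; [exact: tv|rewrite mxE mul_mx_diag !mxE ui mulr0 mulr0].
apply/funext => x; apply/funext => v; rewrite /restrict_form.
case: asboolP => // -[/= [cx xi] tv]; case: asboolP => // _.
have [j ji] : exists j : 'I_N, j != i.
  by exists (lift i (Ordinal hn)); rewrite eq_sym neq_lift.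
apply: (@polyfun_face_eq0 D (w^~ v) (pred1 i) j (pw v)) => //=; last first.
  by move=> l /eqP->.
move=> y cy y0.
have [||u [v' [tu yE ->]]] := @tangent_lift k y v.
- by split=> // a; have [] := tv a.
- by move=> a l /eqP; rewrite -y0 => /eqP->; have [_] := tv a; rewrite mxE.
rewrite -yE; apply: (w0 i) => //; apply/eqP.
by have := y0 i; rewrite eqxx -yE mxE sqrf_eq0 => <-.
Qed.

End Simplex.

(** * Splitting the indices of the frame $(u,e_1,\dots,e_n)$ *)

Section Shuffle.
Variables (k l : nat).

(** Index 0 is the outward normal. It becomes the first entry of the second block, the slot filled
    by the radial vector in [interior_radial]. *)
Definition shuffle (i : 'I_(1 + (k + l))) : 'I_k + 'I_(1 + l) :=
  match fintype.split i with
  | inl _ => inr (lshift l ord0)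
  | inr j => match fintype.split j with
             | inl a => inl a
             | inr b => inr (rshift 1 b)
             end
  end.

Definition unshuffle (x : 'I_k + 'I_(1 + l)) : 'I_(1 + (k + l)) :=
  match x with
  | inl a => rshift 1 (lshift l a)
  | inr b => match fintype.split b with
             | inl _ => lshift (k + l) ord0
             | inr b' => rshift 1 (rshift k b')
             end
  end.

Lemma split_lshift m n (i : 'I_m) : fintype.split (lshift n i) = inl i.
Proof. exact: (unsplitK (inl i)). Qed.

Lemma split_rshift m n (i : 'I_n) : fintype.split (rshift m i) = inr i.
Proof. exact: (unsplitK (inr i)). Qed.

Lemma shuffleK : cancel shuffle unshuffle.
Proof.
move=> i; rewrite /shuffle; case: (split_ordP i) => [i0 ->|j ->].
  by rewrite /unshuffle split_lshift (ord1 i0).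
by case: (split_ordP j) => [a ->//|b ->]; rewrite /unshuffle split_rshift.
Qed.

Lemma unshuffleK : cancel unshuffle shuffle.
Proof.
move=> [a|b] /=; first by rewrite /shuffle split_rshift split_lshift.
case: (split_ordP b) => [b0 ->|b' ->]; first by rewrite /shuffle split_lshift (ord1 b0).
by rewrite /shuffle !split_rshift.
Qed.

(** Exchanging the blocks while keeping the row order of the determinant gives the star in the
    opposite direction, without a sign. *)
Definition swap_sum A B (x : A + B) : B + A :=
  match x with inl a => inr a | inr b => inl b end.

Lemma swap_shuffleK : cancel (fun i => swap_sum (shuffle i)) (fun x => unshuffle (swap_sum x)).
Proof. by move=> i /=; rewrite -[RHS]shuffleK; case: (shuffle i). Qed.

Lemma unshuffle_swapK : cancel (fun x => unshuffle (swap_sum x)) (fun i => swap_sum (shuffle i)).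
Proof. by move=> x; rewrite unshuffleK; case: x. Qed.

End Shuffle.

(** * From the Euclidean star to duality on the sphere *)

Section Hodge.
Variable R : realType.

Section Frame.
Variables k l : nat.
Local Notation n := (k + l)%N.
Implicit Types (u : 'rV[R]_n.+1) (e : 'M[R]_(n, n.+1)).

Definition outward_frame u e : 'M[R]_n.+1 := (col_mx u e : 'M[R]_(1 + n, n.+1)).

Lemma oriented_frame_orthogonal u e : carrier sphere u -> oriented_frame u e ->
  (outward_frame u e)^T *m outward_frame u e = 1%:M /\ \det (outward_frame u e) = 1.
Proof.
move=> su [te ee de]; set Q := outward_frame u e.
have ue : u *m e^T = 0.
  apply/rowP => j; rewrite mxE [RHS]mxE -[RHS](te j).
  by apply: eq_bigr => i _; rewrite !mxE.
have QQ : Q *m Q^T = 1%:M.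
  suff : (col_mx u e : 'M[R]_(1 + n, n.+1)) *m (col_mx u e)^T = 1%:M by [].
  rewrite tr_col_mx mul_col_row ee ue.
  have -> : e *m u^T = 0 by rewrite -[LHS]trmxK trmx_mul trmxK ue trmx0.
  have -> : u *m u^T = 1%:M.
    apply/matrixP => a b; rewrite !ord1 mxE [RHS]mxE eqxx -[RHS]su.
    by apply: eq_bigr => i _; rewrite mxE expr2.
  by rewrite -scalar_mx_block.
split; first exact: mulmx1C.
have : \det Q * \det Q = 1 by rewrite -[X in _ * X]det_tr -det_mulmx QQ det1.
have : 0 < \det Q by [].
by move=> d0 /eqP; rewrite -expr2 sqrp_eq1 ?ltW// => /eqP.
Qed.

Lemma outward_frame_inl u e :
  rowsub (fun a => unshuffle (inl a)) (outward_frame u e) = rowsub (lshift l) e.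
Proof. by apply/matrixP => a i; rewrite [LHS]mxE col_mxEd mxE. Qed.

Lemma outward_frame_inr u e :
  rowsub (fun b => unshuffle (inr b)) (outward_frame u e) =
  col_mx u (rowsub (@rshift k l) e).
Proof.
apply/matrixP => b i; rewrite [LHS]mxE /=.
case: (split_ordP b) => [b0 ->|b' ->]; first by rewrite !col_mxEu !ord1.
by rewrite !col_mxEd [RHS]mxE.
Qed.

End Frame.

Lemma tangent_frame n u (e : 'M[R]_(n, n.+1)) m (f : 'I_m -> 'I_n) :
  carrier sphere u -> oriented_frame u e -> tangent_to sphere u (rowsub f e).
Proof.
move=> su [te _ _]; split=> // j; rewrite /= -[RHS](te (f j)).
by apply: eq_bigr => i _; rewrite !mxE.
Qed.

Lemma is_kform_restrict n M p (w : kform R n p) : (forall u, alternate (w u)) ->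
  is_kform M (restrict_form M w).
Proof.
move=> aw; split=> [u v /restrict_form0//|u v v1 v2 j a b t t1 t2 h h1 h2|u v j1 j2 t j12 h].
  by rewrite !restrict_formE//; apply: (aw u).1 h h1 h2.
by rewrite restrict_formE//; apply: (aw u).2 j12 h.
Qed.

Lemma det_reflection_diag n (i : 'I_n.+1) :
  \det (diag_mx (reflection_diag R i)) = -1.
Proof.
rewrite det_diag (bigD1 i)//= big1 ?mulr1 => [|j ji]; first by rewrite mxE eqxx.
by rewrite mxE (negPf ji).
Qed.

Section StarForms.
Variables (n p q : nat) (pos : 'I_n.+1 -> 'I_p + 'I_q) (ipos : 'I_p + 'I_q -> 'I_n.+1).
Hypotheses (posK : cancel pos ipos) (iposK : cancel ipos pos).

Lemma forms_star D (w : kform R n p) : forms D w ->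
  forms D ((fun u => star pos (w u)) : kform R n q).
Proof.
move=> [aw pw]; split=> [u|v]; first exact: alternate_star posK iposK _.
by apply: polyfun_sum => f _; apply: polyfunZ; apply: polyfunZ.
Qed.

Lemma parity_star eps (w : kform R n p) : (forall u, alternate (w u)) -> parity eps w ->
  parity (- eps) ((fun u => star pos (w u)) : kform R n q).
Proof.
move=> aw pw i u v; rewrite /refl (star_mulmxr posK iposK)//; last first.
  by rewrite tr_diag_mx reflection_diagK.
rewrite det_reflection_diag mulN1r mulNr; congr (- _).
rewrite !star_sum mulrCA; congr (_ * _); rewrite mulr_sumr.
by apply: eq_bigr => f _; rewrite mulrCA -(pw i).
Qed.

End StarForms.

Lemma exists_dual k l n (D : multinom n.+1 -> Prop) eps (hkl : (k + l)%N = n) (beta : kform R n k) :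
  forms D beta -> parity eps beta ->
  exists zeta : kform R n l.+1, [/\ forms D zeta, parity (- eps) zeta &
    hodge_dual hkl (restrict_form sphere beta)
      (restrict_form sphere (interior_radial zeta))].
Proof.
(* Once [n] is [k + l], the casts of indices are identities. *)
case: n / hkl D beta => D beta fb pb.
exists (fun u => star (@shuffle k l) (beta u)); split.
- exact: (forms_star (@shuffleK k l) (@unshuffleK k l)).
- exact: (parity_star (@shuffleK k l) (@unshuffleK k l) fb.1).
- move=> u e su oe; rewrite !restrict_formE; try exact: tangent_frame oe.
  have [QQ dQ] := oriented_frame_orthogonal su oe.
  have := star_frame (@shuffleK k l) (@unshuffleK k l) (fb.1 u) QQ dQ.
  rewrite outward_frame_inl outward_frame_inr /interior_radial => H.
  have E m (f : 'I_m -> 'I_(k + l)) : (fun j => cast_ord erefl (f j)) = f.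
    by apply/funext => j; apply: val_inj.
  by rewrite !E -H.
Qed.

(** Brings a form $i_U\zeta$, obtained from a pullback or a division, back to the shape of a dual
    without changing the degree. *)
Lemma exists_predual k l n (D : multinom n.+1 -> Prop) eps (hkl : (k + l)%N = n) (zeta : kform R n l.+1) :
  forms D zeta -> parity eps zeta ->
  exists beta : kform R n k, [/\ forms D beta, parity (- eps) beta &
    hodge_dual hkl (restrict_form sphere beta)
      (restrict_form sphere (interior_radial zeta))].
Proof.
case: n / hkl D zeta => D zeta fz pz.
exists (fun u => star (fun i => swap_sum (@shuffle k l i)) (zeta u)); split.
- exact: (forms_star (@swap_shuffleK k l) (@unshuffle_swapK k l)).
- exact: (parity_star (@swap_shuffleK k l) (@unshuffle_swapK k l) fz.1).
- move=> u e su oe; rewrite !restrict_formE; try exact: tangent_frame oe.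
  have [QQ dQ] := oriented_frame_orthogonal su oe.
  have := star_frame (@swap_shuffleK k l) (@unshuffle_swapK k l) (fz.1 u) QQ dQ.
  rewrite outward_frame_inl outward_frame_inr /interior_radial => H.
  have E m (f : 'I_m -> 'I_(k + l)) : (fun j => cast_ord erefl (f j)) = f.
    by apply/funext => j; apply: val_inj.
  by rewrite !E H.
Qed.


(* The Householder reflection exchanging the first basis vector and u; it is
   the identity, by the convention x / 0 = 0, when the two agree. *)
Lemma exists_orthonormal_complement n (u : 'rV[R]_n.+1) : carrier sphere u ->
  exists e : 'M[R]_(n, n.+1), [/\ e *m e^T = 1%:M, e *m u^T = 0 &
    u^T *m u + e^T *m e = 1%:M].
Proof.
move=> /= su; pose x : 'rV[R]_n.+1 := u - delta_mx 0 0.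
pose s := \sum_i x 0 i ^+ 2.
pose H : 'M[R]_n.+1 := 1%:M - (2 / s) *: (x^T *m x).
have xx : x *m x^T = s%:M.
  apply/matrixP => a b; rewrite !ord1 mxE [RHS]mxE eqxx mulr1n.
  by apply: eq_bigr => i _; rewrite [x^T _ _]mxE expr2.
have HT : H^T = H.
  by rewrite /H linearB /= linearZ /= trmx1 trmx_mul trmxK.
have HH : H *m H = 1%:M.
  have : (x^T *m x) *m (x^T *m x) = s *: (x^T *m x).
    by rewrite -mulmxA (mulmxA x) xx mul_scalar_mx -scalemxAr.
  rewrite /H; move: (x^T *m x) => P PP.
  rewrite mulmxBl mul1mx mulmxBr mulmx1 -scalemxAl -scalemxAr PP !scalerA.
  have [s0|s0] := eqVneq s 0; first by rewrite s0 invr0 mulr0 !mul0r !scale0r !subr0.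
  have -> : 2 / s * (2 / s) * s = 2 / s + 2 / s by field.
  rewrite scalerDl; move: ((2 / s) *: P) => B.
  have -> : B - (B + B) = - B by rewrite opprD addrA subrr sub0r.
  by rewrite opprK subrK.
have sE : s = 2 - 2 * u 0 0.
  rewrite /s /x; under eq_bigr => i _ do rewrite !mxE sqrrB.
  rewrite big_split sumrB /= su (bigD1 0)//= big1 => [|i /negPf i0].
    rewrite (bigD1 0)//= big1 => [|i /negPf i0]; first by ring.
    by rewrite i0 expr0n.
  by rewrite i0 mulr0 mul0rn.
have H0 : row 0 H = u.
  rewrite rowE /H mulmxBr mulmx1 -scalemxAr mulmxA.
  have -> : (delta_mx 0 0 : 'rV[R]_n.+1) *m x^T = (u 0 0 - 1)%:M.
    by apply/matrixP => a b; rewrite !ord1 -rowE !mxE !eqxx.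
  rewrite mul_scalar_mx scalerA.
  have [s0|s0] := eqVneq s 0.
    have x0 : x = 0.
      apply/rowP => i; rewrite [RHS]mxE; apply/eqP.
      move/eqP: s0; rewrite psumr_eq0 => [/allP/(_ i)|? _]; last exact: sqr_ge0.
      by rewrite mem_index_enum sqrf_eq0 => /(_ isT).
    by rewrite s0 invr0 mulr0 mul0r scale0r subr0; apply/esym/eqP; rewrite -subr_eq0 -/x x0.
  have -> : 2 / s * (u 0 0 - 1) = -1.
    by apply: (mulIf s0); rewrite mulrAC mulfVK// sE; ring.
  by rewrite scaleN1r opprK /x addrC subrK.
clearbody H; pose e : 'M[R]_(n, n.+1) := dsubmx (H : 'M[R]_(1 + n, n.+1)).
have HE : H = col_mx u e :> 'M[R]_(1 + n, n.+1).
  rewrite -[LHS](vsubmxK (H : 'M[R]_(1 + n, n.+1))); congr col_mx.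
  apply/rowP => i; rewrite mxE -[in RHS]H0 [RHS]mxE; congr (H _ _).
  exact: val_inj.
have [_ _ eu ee] : [/\ u *m u^T = 1%:M, u *m e^T = 0, e *m u^T = 0 & e *m e^T = 1%:M].
  have E : (col_mx u e : 'M[R]_(1 + n, n.+1)) *m (col_mx u e)^T = H *m H^T by rewrite -HE.
  move: E; rewrite HT HH tr_col_mx mul_col_row.
  by move=> E; apply: eq_block_mx; rewrite -scalar_mx_block.
exists e; split=> //.
have E : (col_mx u e : 'M[R]_(1 + n, n.+1))^T *m (col_mx u e) = H^T *m H by rewrite -HE.
by move: E; rewrite HT HH tr_col_mx mul_row_col.
Qed.
End Hodge.

Lemma perm_extend_rshift k l (f : 'I_l -> 'I_(k + l)) : injective f ->
  exists s : 'S_(k + l), forall b, s (rshift k b) = f b.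
Proof.
move=> fi; pose A : {set 'I_(k + l)} := ~: (f @: predT).
have cA : k = #|A|.
  by rewrite cardsCs finset.setCK card_imset// !card_ord addnK.
pose g (i : 'I_(k + l)) := match fintype.split i with
  inl a => enum_val (cast_ord cA a) | inr b => f b end.
have gA (a : 'I_k) b : enum_val (cast_ord cA a) != f b.
  apply: contraTneq (enum_valP (cast_ord cA a)) => ->.
  by rewrite finset.in_setC negbK imset_f.
have gi : injective g.
  move=> i j; rewrite /g.
  case: (split_ordP i) => [a ->|b ->]; case: (split_ordP j) => [a' ->|b' ->].
  - by move=> /enum_val_inj /cast_ord_inj->.
  - by move/eqP; rewrite (negPf (gA _ _)).
  - by move/esym/eqP; rewrite (negPf (gA _ _)).
  - by move=> /fi->.
by exists (perm gi) => b; rewrite permE /g split_rshift.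
Qed.

Lemma perm_extend n p (c f : 'I_p -> 'I_n) : injective c -> injective f ->
  exists s : 'S_n, forall b, s (c b) = f b.
Proof.
move=> ci fi; have pn : (p <= n)%N.
  by rewrite -[p]card_ord -[n]card_ord; apply: leq_card ci.
have nE := subnK pn; move: (n - p)%N nE => k nE.
case: n / nE c f ci fi {pn} => c f ci fi.
have [s sE] := perm_extend_rshift ci; have [t tE] := perm_extend_rshift fi.
by exists (s^-1 * t)%g => b; rewrite permM -sE permK tE.
Qed.

(** * Uniqueness of duals on the sphere *)

Section HodgeStar.
Variable R : realType.

Lemma tangent_sphereP n (u : 'rV[R]_n.+1) k (v : 'M[R]_(k, n.+1)) :
  tangent_to sphere u v <-> carrier sphere u /\ v *m u^T = 0.
Proof.
have E j : (v *m u^T) j 0 = \sum_i u 0 i * row j v 0 i.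
  by rewrite mxE; apply: eq_bigr => i _; rewrite !mxE mulrC.
split=> -[su tv]; split=> //.
  by apply/matrixP => j a; rewrite ord1 E [RHS]mxE; apply: tv.
by move=> j; rewrite /= -E tv mxE.
Qed.

(** A form on the sphere is multilinear on tangent vectors only; in coordinates with respect to
    tangent vectors [e] this restriction disappears. *)
Lemma is_kform_sphere_alternate n l (w : kform R n l) u m (e : 'M[R]_(m, n.+1)) :
  is_kform sphere w -> carrier sphere u -> e *m u^T = 0 ->
  alternate (fun c => w u (c *m e)).
Proof.
move=> [_ mw aw] su eu.
have tc (c : 'M[R]_(l, m)) : tangent_to sphere u (c *m e).
  by apply/tangent_sphereP; split=> //; rewrite -mulmxA eu mulmx0.
have row'M (B : 'M[R]_(l, m)) j : row' j (B *m e) = row' j B *m e.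
  by apply/matrixP => x y; rewrite !mxE; apply: eq_bigr => z _; rewrite !mxE.
split=> [v v1 v2 j a b h h1 h2|v j1 j2 j12 h].
  apply: (mw u _ _ _ j) => //; try exact: tc.
  - by rewrite !row_mul h mulmxDl !scalemxAl.
  - by rewrite !row'M h1.
  - by rewrite !row'M h2.
by apply: aw (tc _) j12 _; rewrite !row_mul h.
Qed.

(** A reordered frame may have the wrong orientation; changing the sign of one of its vectors,
    available since $n\ge1$, repairs it. *)
Lemma oriented_frame_perm n (u : 'rV[R]_n.+1) (e : 'M[R]_(n, n.+1)) (s : 'S_n) :
  (1 <= n)%N -> carrier sphere u -> e *m e^T = 1%:M -> e *m u^T = 0 ->
  exists2 d : 'rV[R]_n, (forall i, d 0 i != 0) &
    oriented_frame u (diag_mx d *m row_perm s e).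
Proof.
move=> hn su ee eu; pose E := row_perm s e.
have EE : E *m E^T = 1%:M.
  rewrite /E row_permE trmx_mul -mulmxA (mulmxA e) ee mul1mx.
  by rewrite tr_perm_mx -perm_mxM mulgV perm_mx1.
have Eu : E *m u^T = 0 by rewrite /E row_permE -mulmxA eu mulmx0.
have uu : u *m u^T = 1%:M.
  apply/matrixP => a b; rewrite !ord1 mxE [RHS]mxE eqxx -[RHS]su.
  by apply: eq_bigr => i _; rewrite mxE expr2.
pose D := \det (col_mx u E : 'M[R]_(1 + n)).
have D0 : D != 0.
  have : D * D = 1.
    rewrite /D -[X in _ * X]det_tr -det_mulmx tr_col_mx mul_col_row EE Eu uu.
    have -> : u *m E^T = 0 by rewrite -[LHS]trmxK trmx_mul trmxK Eu trmx0.
    by rewrite -scalar_mx_block det1.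
  by move=> DD; apply: contra_eqN DD => /eqP->; rewrite mul0r eq_sym oner_neq0.
pose i0 := Ordinal hn.
pose d : 'rV[R]_n := \row_i (if i == i0 then Num.sg D else 1).
have d2 i : d 0 i * d 0 i = 1.
  rewrite mxE; case: eqP => _; last by rewrite mulr1.
  by rewrite -expr2 sqr_sg D0.
exists d; first by move=> i; apply: contra_eqN (d2 i) => /eqP->; rewrite mul0r eq_sym oner_neq0.
split.
- have [//] : tangent_to sphere u (diag_mx d *m E).
  by apply/tangent_sphereP; split=> //; rewrite -mulmxA Eu mulmx0.
- rewrite trmx_mul tr_diag_mx -mulmxA (mulmxA E) EE mul1mx mulmx_diag.
  by apply/matrixP => i j; rewrite !mxE -/(d 0 i) ; have := d2 i; rewrite mxE => ->.
- suff : 0 < \det (col_mx u (diag_mx d *m E) : 'M[R]_(1 + n)) by [].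
  have -> : (col_mx u (diag_mx d *m E) : 'M[R]_(1 + n)) =
      block_mx 1%:M 0 0 (diag_mx d) *m col_mx u E.
    by rewrite mul_block_col mul1mx !mul0mx addr0 add0r.
  rewrite det_mulmx det_ublock det1 mul1r -/D det_diag (bigD1 i0)//= big1.
    by rewrite mxE eqxx mulr1 -normrEsg normr_gt0.
  by move=> i /negPf ii0; rewrite mxE ii0.
Qed.

(** Any choice of distinct basis vectors becomes the slots [c] of a reordered frame; the sign
    changes scale both forms by the same nonzero factor. *)
Lemma kform_sphere_eq n p (c : 'I_p -> 'I_n) (u : 'rV[R]_n.+1) (w1 w2 : kform R n p) :
  (1 <= n)%N -> injective c -> carrier sphere u ->
  is_kform sphere w1 -> is_kform sphere w2 ->
  (forall e, oriented_frame u e -> w1 u (rowsub c e) = w2 u (rowsub c e)) ->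
  forall v, w1 u v = w2 u v.
Proof.
move=> hn ci su k1 k2 w12 v.
have [|nt] := pselect (tangent_to sphere u v); last first.
  by case: k1 => z1 _ _; case: k2 => z2 _ _; rewrite z1// z2.
move=> /tangent_sphereP[_ vu].
have [e [ee eu ue]] := exists_orthonormal_complement su.
have -> : v = (v *m e^T) *m e.
  by rewrite -[LHS]mulmx1 -ue mulmxDr !mulmxA vu mul0mx add0r.
have a1 := is_kform_sphere_alternate k1 su eu.
have a2 := is_kform_sphere_alternate k2 su eu.
apply: (multilinear_eq a1.1 a2.1) => f.
have [/injectiveP fi|nf] := boolP (injectiveb f); last first.
  by rewrite (alternate_basis_noninj _ a1 nf) (alternate_basis_noninj _ a2 nf).
have [s sf] := perm_extend ci fi.
have [d d0 oe] := oriented_frame_perm s hn su ee eu.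
set e' := diag_mx d *m row_perm s e in oe.
have e'E : rowsub c e' =
    (diag_mx (\row_b d 0 (c b)) *m basis_rows R f) *m e.
  rewrite -mulmxA /basis_rows mul_rowsub_mx mul1mx /e' !mul_diag_mx.
  by apply/matrixP => b i; rewrite !mxE -sf.
have := w12 _ oe; rewrite e'E.
rewrite (multilinear_diag (w := fun c => w1 u (c *m e)) _ _ a1.1).
rewrite (multilinear_diag (w := fun c => w2 u (c *m e)) _ _ a2.1).
by apply: mulfI; apply/prodf_neq0 => b _; rewrite mxE.
Qed.

(** A dual determines its original pointwise, because uniqueness applies equally to the first [k]
    slots of a frame. *)
Lemma hodge_dual_predual_unique k l n (hkl : (k + l)%N = n) (u : 'rV[R]_n.+1)
    (w1 w2 : kform R n k) (w1' w2' : kform R n l) :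
  (1 <= n)%N -> carrier sphere u -> is_kform sphere w1 -> is_kform sphere w2 ->
  hodge_dual hkl w1 w1' -> hodge_dual hkl w2 w2' ->
  (forall v, w1' u v = w2' u v) -> forall v, w1 u v = w2 u v.
Proof.
move=> hn su k1 k2 h1 h2 h v.
apply: (kform_sphere_eq (c := fun j => cast_ord hkl (lshift l j)) hn _ su k1 k2).
  by move=> i j /cast_ord_inj /lshift_inj.
by move=> e oe; rewrite -h1// h -h2.
Qed.

Lemma hodge_dual_eq k l n (hkl : (k + l)%N = n) (u : 'rV[R]_n.+1)
    (w1 w2 : kform R n k) (w1' w2' : kform R n l) :
  (1 <= n)%N -> carrier sphere u -> is_kform sphere w1' -> is_kform sphere w2' ->
  hodge_dual hkl w1 w1' -> hodge_dual hkl w2 w2' ->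
  (forall v, w1 u v = w2 u v) -> forall v, w1' u v = w2' u v.
Proof.
move=> hn su k1 k2 h1 h2 h v.
apply: (kform_sphere_eq (c := fun j => cast_ord hkl (rshift k j)) hn _ su k1 k2).
  by move=> i j /cast_ord_inj /rshift_inj.
by move=> e oe; rewrite h1// h -h2.
Qed.

Lemma hodge_dual_unique k l n (hkl : (k + l)%N = n) (w : kform R n k)
    (w1 w2 : kform R n l) : (1 <= n)%N ->
  is_kform sphere w1 -> is_kform sphere w2 ->
  hodge_dual hkl w w1 -> hodge_dual hkl w w2 -> w1 = w2.
Proof.
move=> hn k1 k2 h1 h2; apply/funext => u; apply/funext => v.
have [su|nsu] := pselect (carrier sphere u).
  exact: (hodge_dual_eq hn su k1 k2 h1 h2).
case: k1 => z1 _ _; case: k2 => z2 _ _.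
by rewrite z1 ?z2// => -[].
Qed.

Lemma hodge_star_eq k l n (hkl : (k + l)%N = n) (w : kform R n k) (w' : kform R n l) :
  (1 <= n)%N -> is_kform sphere w' -> hodge_dual hkl w w' -> hodge_star hkl w = w'.
Proof.
move=> hn kw' dw'; rewrite /hodge_star; case: xgetP => [w'' _ [k'' d'']|/(_ w')[]//].
exact: hodge_dual_unique d'' dw'.
Qed.

End HodgeStar.

(** * Parity of quotients, and the common frame of the four isomorphisms *)

Section Isomorphisms.
Variables (R : realType) (n : nat).
Local Notation N := n.+1.
Local Notation V := 'rV[R]_N.

(** The Koszul preimage need not have a parity; only its interior product with $U$ does. Averaging
    repairs this and leaves it unchanged on arguments whose first row is radial, the set [T]. *)
Lemma interior_divide_uN_parity (d : int) eps p (theta : kform R n p.+1) : (1 <= n)%N ->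
  eps ^+ 2 = 1 -> forms (deg_eq d) theta -> parity eps theta ->
  (forall i u v, tangent_to sphere u v -> u 0 i = 0 -> interior_radial theta u v = 0) ->
  (d + 1 = N%:Z -> p = 0%N -> eps = 1) ->
  exists zeta : kform R n p.+1, [/\ forms (deg_eq (d - N%:Z)) zeta, parity (- eps) zeta &
    forall u v, interior_radial theta u v = uN u * interior_radial zeta u v].
Proof.
move=> hn e1 ft pt t0 te.
have [|zeta fz zE] := interior_divide_uN hn ft t0.
  by move=> h1 h2; rewrite -(te h1 h2).
have fi : forms (fun=> True) (interior_radial zeta) by apply: forms_interior fz.
have pz i u v : refl i (interior_radial zeta) u v = - eps * interior_radial zeta u v.
  apply/eqP; rewrite -subr_eq0; apply/eqP.
  have pf : polyfun (fun=> True) (fun u => refl i (interior_radial zeta) u v -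
      - eps * interior_radial zeta u v).
    apply: (eq_polyfun (D := fun=> True) _ _ (polyfunDZ 1 eps ((forms_refl i fi).2 v) (fi.2 v))) => // x.
    ring.
  apply: (polyfun_mul_eq0 pf (polyfun_uN R n)); last first.
    by exists (const_mx 1); apply: uN_const1.
  move=> {}u; have := pt i u (col_mx u v : 'M[R]_(1 + p, N)).
  rewrite -/(interior_radial (refl i theta) u v) -/(interior_radial theta u v).
  rewrite refl_interior [in X in X = _]/refl !zE uN_reflection -/(refl i (interior_radial zeta) u v).
  by move: (refl _ _ _ _) (interior_radial _ _ _) => a b h; lra.
pose T (u : V) (W : 'M[R]_(p.+1, N)) := exists v : 'M[R]_(p, N), W = col_mx u v.
have [||||zeta' [fz' pz'] z'E] := @forms_average R n (deg_eq (d - N%:Z)) (- eps) _ zeta T.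
- by rewrite sqrrN.
- exact: fz.
- move=> i u _ [v ->]; exists (v *m diag_mx (reflection_diag R i)).
  by rewrite reflection_mulmx; apply: (mul_col_mx u v).
- by move=> i u _ [v ->]; have := pz i u v; rewrite -refl_interior.
exists zeta'; split=> // u v; rewrite zE; congr (_ * _); rewrite /interior_radial z'E//.
by exists v.
Qed.

Lemma forms_homogenize_int (d : int) k (w : kform R n k) : forms (deg_le d) w ->
  exists2 w', forms (deg_eq d) w' &
    forall (x : V) v, \sum_i x 0 i = 1 -> w' x v = w x v.
Proof.
case: d => d; first exact: forms_homogenize.
move=> fw; exists (fun _ _ => 0); first exact: forms0.
by move=> x v _; rewrite (forms_neg _ fw).
Qed.

(** The differential of [Phi] sends the radial vector $u$ to $2\Phi(u)$, which explains the factor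
    $1/2$. *)
Lemma phis_interior k (w : kform R n k.+1) u v : (forall x, alternate (w x)) ->
  phis (interior_radial w) u v = 2^-1 * interior_radial (phis w) u v.
Proof.
move=> aw; rewrite /phis /interior_radial.
have -> : (col_mx u v : 'M[R]_(1 + k, N)) *m diag_mx (2 *: u) =
    diag_mx (\row_j (if j == lshift k 0 then 2 else 1)) *m
    (col_mx (Phi u) (v *m diag_mx (2 *: u)) : 'M[R]_(1 + k, N)).
  rewrite mul_col_mx; apply/matrixP => i j; rewrite mul_diag_mx [RHS]mxE [X in _ = X * _]mxE.
  case: (split_ordP i) => i0 ->.
    by rewrite (ord1 i0) eqxx !col_mxEu mul_mx_diag !mxE; ring.
  by rewrite !col_mxEd mul1r.
rewrite (@multilinear_diag R (1 + k) N (w (Phi u)) _ _ (aw _).1) (bigD1 (lshift k 0))//= big1 => [|i /negPf i0].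
  by rewrite mxE eqxx mulr1 mulKf// pnatr_eq0.
by rewrite mxE i0.
Qed.

Lemma pullback_linear k (f : V -> V) M a (w1 w2 : kform R n k) :
  pullback M f (a *: w1 + w2) = a *: pullback M f w1 + pullback M f w2.
Proof.
apply/funext => u; apply/funext => v.
rewrite -[RHS]/(a * pullback M f w1 u v + pullback M f w2 u v).
by rewrite /pullback /restrict_form; case: asboolP => // _; rewrite mulr0 addr0.
Qed.

(** Linearity and injectivity are common to all four maps; only the inclusion of the image and
    surjectivity differ. *)
Lemma linear_iso_pullback_Phi k (A B : set (kform R n k)) D :
  (forall w, A w -> exists2 eta, forms D eta & w = restrict_form simplex eta) ->
  (forall w, A w -> B (@pullback R n sphere Phi k w)) ->
  (forall w, B w -> exists2 eta, A (restrict_form simplex eta) &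
     restrict_form sphere (phis eta) = w) ->
  linear_iso A B (@pullback R n sphere Phi k).
Proof.
move=> Af fA fB; split; first by move=> a w1 w2 _ _; apply: pullback_linear.
split=> //; last first.
  by move=> w /fB[eta Ae <-]; exists (restrict_form simplex eta) => //; rewrite pullback_sphere_Phi.
move=> w1 w2; rewrite !inE => /Af[e1 f1 ->] /Af[e2 f2 ->].
rewrite !pullback_sphere_Phi => /eq_restrict_form e12.
apply/eq_restrict_form => x v t.
have fd := formsDZ 1 (-1) f1 f2.
apply/eqP; rewrite -subr_eq0; apply/eqP.
have := phis_inj fd _ t; rewrite mul1r mulN1r; apply=> u v' t'.
by have := e12 u v' t'; rewrite /phis => ->; rewrite mul1r mulN1r subrr.
Qed.

Lemma poly_forms_onE M r k (w : kform R n k) : poly_forms_on M r k w <->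
  exists2 eta, forms (deg_le r) eta & w = restrict_form M eta.
Proof.
by split=> [[eta /poly_formsE fe <-]|[eta fe ->]]; exists eta => //; apply/poly_formsE.
Qed.

Lemma poly_minus_forms_onE M r k (w : kform R n k) : poly_minus_forms_on M r k w <->
  exists2 eta : kform R n k.+1, forms (deg_le (r - 1)) eta &
    w = restrict_form M (interior_radial eta).
Proof.
split=> [[_ [eta /poly_formsE fe <-] <-]|[eta fe ->]]; first by exists eta.
by exists (interior_radial eta) => //; exists eta => //; apply/poly_formsE.
Qed.

Lemma forms_phis_le r r' k (w : kform R n k) : r' = 2 * r + k%:Z ->
  forms (deg_le r) w -> forms (deg_le r') (phis w).
Proof.
move=> ->; apply: forms_phis => m m'; rewrite /deg_le !mdegD => h h'; lia.
Qed.

Lemma forms_phis_eq r r' k (w : kform R n k) : r' = 2 * r + k%:Z ->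
  forms (deg_eq r) w -> forms (deg_eq r') (phis w).
Proof.
move=> ->; apply: forms_phis => m m'; rewrite /deg_eq !mdegD => h h'; lia.
Qed.

Lemma forms_lift_eq r r' k (w : kform R n k) : r' = 2 * r + k%:Z ->
  forms (deg_le r') w -> parity 1 w ->
  exists2 eta, forms (deg_le r) eta & w = phis eta.
Proof. by move=> ->; apply: forms_lift. Qed.

Lemma parityZ eps c k (w : kform R n k) : parity eps w ->
  parity eps ((fun u v => c * w u v) : kform R n k).
Proof. by move=> pw i u v; rewrite /refl -/(refl i w u v) pw mulrCA. Qed.

Lemma formsZ D c k (w : kform R n k) : forms D w ->
  forms D ((fun u v => c * w u v) : kform R n k).
Proof.
move=> fw; have := formsDZ c 0 fw fw.
congr forms; apply/funext => u; apply/funext => v.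
by rewrite mul0r addr0.
Qed.

Lemma forms_uN_le r r' k (w : kform R n k) : r' = r + N%:Z ->
  forms (deg_le r) w -> forms (deg_le r') (fun u v => uN u * w u v).
Proof.
move=> ->; apply: forms_uN => m.
by rewrite /deg_le mdegD mdeg_mindic cardsT card_ord => h; lia.
Qed.

Lemma parity_uN eps k (w : kform R n k) : parity eps w ->
  parity (- eps) ((fun u v => uN u * w u v) : kform R n k).
Proof.
by move=> pw i u v; rewrite /refl uN_reflection -/(refl i w u v) pw; ring.
Qed.

Lemma restrict_uN M k (w : kform R n k) :
  mul_uN (restrict_form M w) = restrict_form M (fun u v => uN u * w u v).
Proof.
apply/funext => u; apply/funext => v; rewrite /mul_uN /restrict_form.
by case: asboolP; rewrite ?mulr0.
Qed.

Lemma sphere_average D eps k (w : kform R n k) : eps ^+ 2 = 1 ->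
  forms D w -> sphere_parity eps w ->
  exists2 w', forms D w' /\ parity eps w' &
    restrict_form sphere w' = restrict_form sphere w.
Proof.
move=> e1 fw sw.
have [||w' fw' w'w] := forms_average (T := fun u v => tangent_to sphere u v) e1 fw.
- by move=> i u v; apply: tangent_reflection.
- exact: sw.
- by exists w' => //; apply/eq_restrict_form.
Qed.

Lemma even_forms_average D k (w : kform R n k) : forms D w ->
  even_forms (restrict_form sphere w) ->
  exists2 w', forms D w' /\ parity 1 w' &
    restrict_form sphere w' = restrict_form sphere w.
Proof. by move=> fw /even_formsE; apply: sphere_average; rewrite ?expr1n. Qed.

Lemma odd_forms_average D k (w : kform R n k) : forms D w ->
  odd_forms (restrict_form sphere w) ->
  exists2 w', forms D w' /\ parity (-1) w' &
    restrict_form sphere w' = restrict_form sphere w.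
Proof. by move=> fw /odd_formsE; apply: sphere_average; rewrite ?sqrrN ?expr1n. Qed.

Lemma parity_even k (w : kform R n k) : parity 1 w -> even_forms (restrict_form sphere w).
Proof. by move=> pw; apply/even_formsE => i u v _; apply: pw. Qed.

Lemma parity_odd k (w : kform R n k) : parity (-1) w -> odd_forms (restrict_form sphere w).
Proof. by move=> pw; apply/odd_formsE => i u v _; apply: pw. Qed.

Lemma is_kform_interior M k (w : kform R n k.+1) : (forall x, alternate (w x)) ->
  is_kform M (restrict_form M (interior_radial w)).
Proof.
move=> aw; apply: is_kform_restrict => u; exact: (alternate_interior u (aw u)).
Qed.

End Isomorphisms.

(** * The four isomorphisms *)

Section PullbackIsomorphisms.
Variables (R : realType) (n k l : nat) (r : int) (hn : (1 <= n)%N) (hlk : (l + k)%N = n).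
Local Notation N := n.+1.
Local Notation V := 'rV[R]_N.
Local Notation pullPhi := (@pullback R n sphere Phi k).

Lemma iso_poly_forms :
  linear_iso (poly_forms_on simplex r k)
    (poly_forms_on sphere (2 * r + k%:Z) k `&` even_forms)%classic pullPhi.
Proof.
apply: (@linear_iso_pullback_Phi R n k _ _ (deg_le r)).
- by move=> w /poly_forms_onE.
- move=> w /poly_forms_onE[eta fe ->]; rewrite pullback_sphere_Phi; split.
    by apply/poly_forms_onE; exists (phis eta) => //; apply: forms_phis_le fe.
  exact/parity_even/phis_parity.
- move=> _ [/poly_forms_onE[w fw ->] /(even_forms_average fw)[w' [fw' pw'] <-]].
  have [eta fe ->] := forms_lift fw' pw'.
  by exists eta => //; apply/poly_forms_onE; exists eta.
Qed.

Lemma hodge_star_interior (beta : kform R n l) (zeta : kform R n k.+1) :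
  (forall u, alternate (zeta u)) ->
  hodge_dual hlk (restrict_form sphere beta)
    (restrict_form sphere (interior_radial zeta)) ->
  hodge_star hlk (restrict_form sphere beta) =
    restrict_form sphere (interior_radial zeta).
Proof. by move=> az; apply: hodge_star_eq => //; apply: is_kform_interior. Qed.

Lemma phis_half_interior (eta : kform R n k.+1) : (forall u, alternate (eta u)) ->
  phis (interior_radial eta) =
  interior_radial ((fun u v => 2^-1 * phis eta u v) : kform R n k.+1).
Proof. by move=> ae; apply/funext => u; apply/funext => v; rewrite phis_interior. Qed.

(** Here $2r+k-1=2(r-1)+(k+1)$ is the degree of pullbacks of $(k+1)$-forms of degree $r-1$. Lifting
    $2\zeta$ instead of $\zeta$ compensates the factor $1/2$. *)
Lemma lift_interior (s : int) (zeta : kform R n k.+1) :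
  s = 2 * r + k%:Z - 1 -> forms (deg_le s) zeta -> parity 1 zeta ->
  exists2 eta, forms (deg_le (r - 1)) eta &
    phis (interior_radial eta) = interior_radial zeta.
Proof.
move=> sE fz pz.
have [|eta fe e2] := @forms_lift_eq R n (r - 1) s k.+1 _ _ (formsZ 2 fz) (parityZ 2 pz).
  by rewrite sE; lia.
exists eta => //; rewrite phis_half_interior; last exact: fe.1.
apply/funext => u; apply/funext => v; rewrite /interior_radial -e2.
by rewrite mulKf// pnatr_eq0.
Qed.

Lemma iso_poly_minus_forms :
  linear_iso (poly_minus_forms_on simplex r k)
    [set hodge_star hlk w | w in
       poly_forms_on sphere (2 * r + k%:Z - 1) l `&` odd_forms]%classic pullPhi.
Proof.
apply: (@linear_iso_pullback_Phi R n k _ _ (deg_le r)).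
- move=> w /poly_minus_forms_onE[eta fe ->]; exists (interior_radial eta) => //.
  by apply: forms_interior fe => m i; rewrite /deg_le mdegD mdeg1; lia.
- move=> w /poly_minus_forms_onE[eta fe ->]; rewrite pullback_sphere_Phi.
  rewrite phis_half_interior; last exact: fe.1.
  set theta := (X in interior_radial X).
  have ft : forms (deg_le (2 * r + k%:Z - 1)) theta.
    by apply: formsZ; apply: forms_phis_le fe; lia.
  have pt : parity 1 theta by apply: parityZ; apply: phis_parity.
  have [beta [fb pb db]] := exists_predual hlk ft pt.
  exists (restrict_form sphere beta); last by apply: hodge_star_interior ft.1 db.
  by split; [apply/poly_forms_onE; exists beta|exact: parity_odd].
- move=> _ [_ [/poly_forms_onE[w fw ->] /(odd_forms_average fw)[b [fb pb] <-]] <-].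
  have [zeta [fz pz dz]] := exists_dual hlk fb pb.
  rewrite opprK in pz.
  have [eta fe eE] := lift_interior erefl fz pz.
  exists (interior_radial eta); first by apply/poly_minus_forms_onE; exists eta.
  by rewrite eE (hodge_star_interior fz.1 dz).
Qed.

Lemma iso_poly_forms_vanishing : 1 <= r ->
  linear_iso (poly_forms_on simplex r k `&` vanishing_on_boundary)%classic
    [set mul_uN w | w in
       poly_forms_on sphere (2 * r + k%:Z - n%:Z - 1) k `&` odd_forms]%classic pullPhi.
Proof.
move=> r1; apply: (@linear_iso_pullback_Phi R n k _ _ (deg_le r)).
- by move=> w [/poly_forms_onE].
- move=> _ [/poly_forms_onE[eta0 fe0 ->]].
  have [eta fe etaE] := forms_homogenize_int fe0.
  have <- : restrict_form simplex eta = restrict_form simplex eta0.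
    by apply/eq_restrict_form => x v [[_ x1] _]; apply: etaE.
  move=> /(vanishing_on_boundaryP hn fe) van; rewrite pullback_sphere_Phi.
  set w := phis eta in van *.
  have fw : forms (deg_eq (2 * r + k%:Z)) w by apply: forms_phis_eq fe.
  have pw : parity 1 w by apply: phis_parity.
  have hkl : (k + l)%N = n by rewrite addnC.
  (* [w] is known to vanish only on tangent vectors, so its dual is divided by $u_N$ instead. *)
  have [zeta [fz pz dz]] := exists_dual hkl fw pw.
  have d0 : hodge_dual hkl ((fun _ _ => 0) : kform R n k) ((fun _ _ => 0) : kform R n l).
    by [].
  have k0 p : is_kform sphere ((fun _ _ => 0) : kform R n p).
    by split=> // *; rewrite !mulr0 addr0.
  (* At a point with $u_i=0$ the form [w] agrees with 0 on the sphere, hence so do the duals. *)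
  have z0 i u v : tangent_to sphere u v -> u 0 i = 0 -> interior_radial zeta u v = 0.
    move=> t ui; rewrite -(restrict_formE _ t).
    apply: (hodge_dual_eq hn t.1 (is_kform_interior _ fz.1) (k0 l) dz d0) => v'.
    have [t'|t'] := pselect (tangent_to sphere u v'); last by rewrite restrict_form0.
    by rewrite restrict_formE//; apply: van ui.
  have [||zeta' [fz' pz' zE]] := interior_divide_uN_parity hn _ fz pz z0.
  - by rewrite sqrrN expr1n.
  (* The exceptional case would give $k=n$ and $r=0$, against $r\ge1$. *)
  - by move=> h l0; lia.
  rewrite opprK in pz'.
  have [beta [fb pb db]] := exists_predual hkl fz' pz'.
  exists (restrict_form sphere beta).
    split; last exact: parity_odd.
    apply/poly_forms_onE; exists beta => //; apply: forms_sub fb => m.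
    by rewrite /deg_eq /deg_le; lia.
  rewrite restrict_uN; apply/eq_restrict_form => u v t.
  have kw p (w' : kform R n p) : (forall u, alternate (w' u)) ->
      is_kform sphere (restrict_form sphere w') by apply: is_kform_restrict.
  rewrite -(restrict_formE w t).
  rewrite -[LHS](restrict_formE ((fun u v => uN u * beta u v) : kform R n k) t).
  have fub : forms (fun=> True) (fun u v => uN u * beta u v) by apply: forms_uN fb.
  (* On the sphere both $u_N\beta$ and [w] have the dual $u_N\,i_U\zeta'$. *)
  apply: (hodge_dual_predual_unique hn t.1 (kw _ _ fub.1) (kw _ _ fw.1) _ dz (w1' :=
      fun u v => uN u * restrict_form sphere (interior_radial zeta') u v)).
    move=> u' e su oe; rewrite db// restrict_formE ?restrict_formE//;
      exact: tangent_frame oe.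
  move=> v'; have [t'|t'] := pselect (tangent_to sphere u v').
    by rewrite !restrict_formE// zE.
  by rewrite !restrict_form0// mulr0.
- move=> _ [_ [/poly_forms_onE[w0 fw0 ->] /(odd_forms_average fw0)[w [fw pw] <-]] <-].
  have fuw : forms (deg_le (2 * r + k%:Z)) (fun u v => uN u * w u v).
    by apply: forms_uN_le fw; lia.
  have puw : parity 1 ((fun u v => uN u * w u v) : kform R n k).
    by rewrite -[1]opprK; apply: parity_uN.
  have [eta fe eE] := forms_lift fuw puw.
  exists eta; last by rewrite -eE restrict_uN.
  split; first by apply/poly_forms_onE; exists eta.
  apply/(vanishing_on_boundaryP hn fe) => i u v _ ui; rewrite -eE.
  by rewrite /uN (bigD1 i)//= ui !mul0r.
Qed.

Lemma iso_poly_minus_forms_vanishing :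
  linear_iso (poly_minus_forms_on simplex r k `&` vanishing_on_boundary)%classic
    [set mul_uN (hodge_star hlk w) | w in
       poly_forms_on sphere (2 * r + k%:Z - n%:Z - 2) l `&` even_forms]%classic pullPhi.
Proof.
have interior_le (eta : kform R n k.+1) : forms (deg_le (r - 1)) eta ->
    forms (deg_le r) (interior_radial eta).
  by apply: forms_interior => m i; rewrite /deg_le mdegD mdeg1; lia.
apply: (@linear_iso_pullback_Phi R n k _ _ (deg_le r)).
- move=> w [/poly_minus_forms_onE[eta fe ->] _]; exists (interior_radial eta) => //.
  exact: interior_le.
- move=> _ [/poly_minus_forms_onE[eta0 fe0 ->]].
  have [eta fe etaE] := forms_homogenize_int fe0.
  have <- : restrict_form simplex (interior_radial eta) =
      restrict_form simplex (interior_radial eta0).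
    by apply/eq_restrict_form => x v [[_ x1] _]; apply: etaE.
  have fie : forms (deg_le r) (interior_radial eta).
    by apply: interior_le; apply: forms_sub fe => m; rewrite /deg_eq /deg_le => ->.
  move=> /(vanishing_on_boundaryP hn fie); rewrite pullback_sphere_Phi.
  rewrite phis_half_interior; last exact: fe.1.
  set theta := (X in interior_radial X) => van.
  have ft : forms (deg_eq (2 * r + k%:Z - 1)) theta.
    by apply: formsZ; apply: forms_phis_eq fe; lia.
  have pt : parity 1 theta by apply: parityZ; apply: phis_parity.
  (* The form to divide already is an interior product with $U$, and [theta] is even, so the
     exceptional case is excluded for every [r]. *)
  have [|//|zeta [fz pz zE]] := interior_divide_uN_parity hn _ ft pt van.
    by rewrite expr1n.
  have [beta [fb pb db]] := exists_predual hlk fz pz.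
  rewrite opprK in pb.
  exists (restrict_form sphere beta).
    split; last exact: parity_even.
    apply/poly_forms_onE; exists beta => //; apply: forms_sub fb => m.
    by rewrite /deg_eq /deg_le; lia.
  rewrite (hodge_star_interior fz.1 db) restrict_uN.
  by apply/eq_restrict_form => u v _; rewrite zE.
- move=> _ [_ [/poly_forms_onE[w fw ->] /(even_forms_average fw)[b [fb pb] <-]] <-].
  have [zeta [fz pz dz]] := exists_dual hlk fb pb.
  have fuz : forms (deg_le (2 * r + k%:Z - 1)) (fun u v => uN u * zeta u v).
    by apply: forms_uN_le fz; lia.
  have puz : parity 1 ((fun u v => uN u * zeta u v) : kform R n k.+1).
    by rewrite -[1]opprK; apply: parity_uN.
  have [eta fe eE] := lift_interior erefl fuz puz.
  exists (interior_radial eta); last first.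
    by rewrite eE (hodge_star_interior fz.1 dz) restrict_uN.
  split; first by apply/poly_minus_forms_onE; exists eta.
  apply/(vanishing_on_boundaryP hn (interior_le _ fe)) => i u v _ ui; rewrite eE.
  by rewrite /interior_radial /uN (bigD1 i)//= ui !mul0r.
Qed.

End PullbackIsomorphisms.

Local Open Scope classical_set_scope.
Local Open Scope ring_scope.

Theorem theorem3p2 (R : realType) (n k : nat) (r : int)
    (hn : (1 <= n)%N) (hk : (k <= n)%N) :
  let star := @hodge_star R n (n - k) k (subnK hk) in
  let pullPhi := @pullback R n sphere Phi k in
  [/\ linear_iso (poly_forms_on simplex r k)
        (poly_forms_on sphere (2 * r + k%:Z) k `&` even_forms)
        pullPhi,
      linear_iso (poly_minus_forms_on simplex r k)
        [set star w | w in
          poly_forms_on sphere (2 * r + k%:Z - 1) (n - k) `&` odd_forms]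
        pullPhi,
      1 <= r ->
      linear_iso (poly_forms_on simplex r k `&` vanishing_on_boundary)
        [set mul_uN w | w in
          poly_forms_on sphere (2 * r + k%:Z - n%:Z - 1) k `&` odd_forms]
        pullPhi &
      linear_iso (poly_minus_forms_on simplex r k `&` vanishing_on_boundary)
        [set mul_uN (star w) | w in
          poly_forms_on sphere (2 * r + k%:Z - n%:Z - 2) (n - k) `&`
          even_forms]
        pullPhi].
Proof.
move=> star pullPhi; split.
- exact: iso_poly_forms.
- exact: iso_poly_minus_forms.
- exact: iso_poly_forms_vanishing (subnK hk).
- exact: iso_poly_minus_forms_vanishing.
Qed.
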